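(* Assume (As1) and (As2) (see context) and consider the alternating direction method of multipliers (ADMM) iterations [S1]–[S3] for problem (P6), all defined in the context. If $\mathbf{\Gamma}^{(l)}_j(0)=\mathbf{\Lambda}^{(l)}_j(0)=\mathbf{0}$ for all $l=1,\dots,L$ and $j\in\bar{\mathcal{N}}^{(l)}$, then [S1]–[S3] boil down to (i.e. are equivalent to) the following primal-dual updates. [S1$'$] For each area $l=1,\dots,L$, obtain $\mathbf{V}^{(l)}(i+1)$ as the $\mathbf{V}^{(l)}$-component of a solution of $$(\mathrm{P7}^{(l)})\quad \min_{\mathbf{V}^{(l)}\succeq\mathbf{0},\,\{\alpha_j\ge0,\beta_j\ge0\}_{j\in\bar{\mathcal{N}}^{(l)}}}\ \mathcal{L}^{(l)}(\mathbf{V}^{(l)},\{\alpha_j,\beta_j\})$$ subject to $\mathbf{V}^{(l)}\in\mathcal{B}^{(l)}$ and, for all $j\in\bar{\mathcal{N}}^{(l)}$, $$\begin{bmatrix}-\alpha_j&\mathbf{r}_{j,\Re}^{\mathcal{T}}\\ \mathbf{r}_{j,\Re}&-\mathbf{I}\end{bmatrix}\preceq\mathbf{0},\qquad \begin{bmatrix}-\beta_j&\mathbf{r}_{j,\Im}^{\mathcal{T}}\\ \mathbf{r}_{j,\Im}&-\mathbf{I}\end{bmatrix}\preceq\mathbf{0},$$ where $$\mathcal{L}^{(l)}(\mathbf{V}^{(l)},\{\alpha_j,\beta_j\}):=\tilde C_k^{(l)}(\mathbf{V}^{(l)})+\sum_{j\in\bar{\mathcal{N}}^{(l)}}\frac{\kappa}{2}(\alpha_j+\beta_j)+\sum_{j\in\bar{\mathcal{N}}^{(l)}}\Big[\mathrm{Tr}\big((\mathbf{\Gamma}_j^{(l)}(i))^{\mathcal{T}}\Re\{\mathbf{V}_j^{(l)}\}\big)+\mathrm{Tr}\big((\mathbf{\Lambda}_j^{(l)}(i))^{\mathcal{T}}\Im\{\mathbf{V}_j^{(l)}\}\big)\Big]$$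 and the vectors $\mathbf{r}_{j,\Re}$ and $\mathbf{r}_{j,\Im}$ collect the real and imaginary parts, respectively, of the entries of $\mathbf{V}_j^{(l)}-\frac12(\mathbf{V}_j^{(l)}(i)+\mathbf{V}_l^{(j)}(i))$. [S2$'$] For each area $l=1,\dots,L$ and $j\in\bar{\mathcal{N}}^{(l)}$, $$\mathbf{\Gamma}_j^{(l)}(i+1)=\mathbf{\Gamma}_j^{(l)}(i)+\frac{\kappa}{2}\big(\Re\{\mathbf{V}_j^{(l)}(i+1)\}-\Re\{\mathbf{V}_l^{(j)}(i+1)\}\big),$$ $$\mathbf{\Lambda}_j^{(l)}(i+1)=\mathbf{\Lambda}_j^{(l)}(i)+\frac{\kappa}{2}\big(\Im\{\mathbf{V}_j^{(l)}(i+1)\}-\Im\{\mathbf{V}_l^{(j)}(i+1)\}\big).$$ Furthermore, for any $\kappa>0$ the iterates $\{\mathbf{V}^{(l)}(i)\}$, $\{\mathbf{\Gamma}_j^{(l)}(i),\mathbf{\Lambda}_j^{(l)}(i)\}$ produced by [S1$'$]–[S2$'$] are convergent, and $\lim_{i\to+\infty}\mathbf{V}^{(l)}(i)=\mathbf{V}^{(l)}_{\mathrm{opt}}$ for all $l=1,\dots,L$, where $\{\mathbf{V}^{(l)}_{\mathrm{opt}}\}$ are the sub-matrices (indexed by the phases of the nodes of $\bar{\mathcal{A}}^{(l)}$) of the optimal solution $\mathbf{V}_{\mathrm{opt}}$ of (P3).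
   Context: Network. Nodes $\mathcal{N}=\{0,1,\dots,N\}$ (node $0$ is the point of common coupling, PCC), set of lines $\mathcal{E}\subset\mathcal{N}\times\mathcal{N}$ (undirected lines, each listed once), $\mathcal{N}_n$ the set of nodes joined to $n$ by a line. $\mathcal{P}_n\subseteq\{a,b,c\}$ is the nonempty set of phases at node $n$ (with $\mathcal{P}_0=\{a,b,c\}$), $\mathcal{P}_{mn}\subseteq\mathcal{P}_m\cap\mathcal{P}_n$ the phases of line $(m,n)$. Each line has an invertible phase impedance matrix $\mathbf{Z}_{mn}=\mathbf{Z}_{nm}$ and a shunt admittance matrix $\mathbf{Y}^{(s)}_{mn}=\mathbf{Y}^{(s)}_{nm}$ in $\mathbb{C}^{|\mathcal{P}_{mn}|\times|\mathcal{P}_{mn}|}$. $\mathbf{v}_n$ stacks the complex voltages $V_n^\phi$, $\phi\in\mathcal{P}_n$, and $\mathbf{v}$ stacks all $\mathbf{v}_n$; $\mathbf{v}_0\in\mathbb{C}^3$ is a given reference. $\mathcal{S}\subset\mathcal{N}\setminus\{0\}$ is the set of nodes with distributed generation; $P_{L,n}^\phi,Q_{L,n}^\phi$ are given real loads, $y_{C,n}^\phi$ given real susceptances, $V_n^{\min},V_n^{\max}\ge0$ and $P_{G,s}^{\min},P_{G,s}^{\max},Q_{G,s}^{\min},Q_{G,s}^{\max}$ given limits, $c_0>0$, $c_s\ge0$ given costs. $(\cdot)^{\mathcal{T}}$ is transpose, $(\cdot)^{\mathcal{H}}$ conjugate transpose, $[\cdot]_{\mathcal{P},\mathcal{P}'}$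 a sub-matrix, $\|\cdot\|_F$ the Frobenius norm, $j=\sqrt{-1}$ when used as a number. Matrices. $\mathbf{Y}$ (taken symmetric) is the block matrix whose $(m,n)$ off-diagonal block for a line is $-\mathbf{Z}_{mn}^{-1}$ on rows/columns $\mathcal{P}_{mn}$ and zero on other phases, whose $n$-th diagonal block is $\sum_{m\in\mathcal{N}_n}(\frac12\mathbf{Y}_{mn}^{(s)}+\mathbf{Z}_{mn}^{-1})$ (each summand zero-padded on phases in $\mathcal{P}_n\setminus\mathcal{P}_{mn}$), and whose other blocks are zero. $\bar{\mathbf{e}}_n^\phi$ is the canonical basis vector of $\mathbb{R}^{\sum_n|\mathcal{P}_n|}$ associated with node $n$, phase $\phi$; $\mathbf{Y}_n^\phi:=\bar{\mathbf{e}}_n^\phi(\bar{\mathbf{e}}_n^\phi)^{\mathcal{T}}\mathbf{Y}$; $\mathbf{\Phi}_{P,n}^\phi:=\frac12(\mathbf{Y}_n^\phi+(\mathbf{Y}_n^\phi)^{\mathcal{H}})$; $\mathbf{\Phi}_{Q,n}^\phi:=\frac{\sqrt{-1}}{2}(\mathbf{Y}_n^\phi-(\mathbf{Y}_n^\phi)^{\mathcal{H}})$; $\mathbf{\Phi}_{V,n}^\phi:=\bar{\mathbf{e}}_n^\phi(\bar{\mathbf{e}}_n^\phi)^{\mathcal{T}}$; $\mathbf{\Phi}_{m\to n}:=\frac12(\mathbf{A}_{m\to n}^{\mathcal{H}}\mathbf{B}_m+\mathbf{B}_m^{\mathcal{H}}\mathbf{A}_{m\to n})$, where $\mathbf{A}_{m\to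 n}\mathbf{v}=\mathbf{Z}_{mn}^{-1}([\mathbf{v}_m]_{\mathcal{P}_{mn}}-[\mathbf{v}_n]_{\mathcal{P}_{mn}})$ and $\mathbf{B}_m\mathbf{v}=[\mathbf{v}_m]_{\mathcal{P}_{mn}}$ for all $\mathbf{v}$. Problem (P3), for a fixed $k\in\{1,2\}$. Minimize $\tilde C_k(\mathbf{V})$ over Hermitian $\mathbf{V}$, where $\tilde C_1(\mathbf{V})=\sum_{(m,n)\in\mathcal{E}}(\mathrm{Tr}(\mathbf{\Phi}_{m\to n}\mathbf{V})+\mathrm{Tr}(\mathbf{\Phi}_{n\to m}\mathbf{V}))$, $\tilde C_2(\mathbf{V})=\sum_{s\in\mathcal{S}\cup\{0\}}c_s\sum_{\phi\in\mathcal{P}_s}\mathrm{Tr}(\mathbf{\Phi}_{P,s}^\phi\mathbf{V})$, subject to: (a) $\mathrm{Tr}(\mathbf{\Phi}_{P,n}^\phi\mathbf{V})+P_{L,n}^\phi=0$ and (b) $\mathrm{Tr}(\mathbf{\Phi}_{Q,n}^\phi\mathbf{V})+Q_{L,n}^\phi-y_{C,n}^\phi\mathrm{Tr}(\mathbf{\Phi}_{V,n}^\phi\mathbf{V})=0$ for $n\in\mathcal{N}\setminus(\mathcal{S}\cup\{0\})$, $\phi\in\mathcal{P}_n$; (c) $P_{G,s}^{\min}\le\mathrm{Tr}(\mathbf{\Phi}_{P,s}^\phi\mathbf{V})+P_{L,s}^\phi\le P_{G,s}^{\max}$ and (d) $Q_{G,s}^{\min}\le\mathrm{Tr}(\mathbf{\Phi}_{Q,s}^\phi\mathbf{V})+Q_{L,s}^\phi\le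 Q_{G,s}^{\max}$ for $s\in\mathcal{S}$, $\phi\in\mathcal{P}_s$; (e) $(V_n^{\min})^2\le\mathrm{Tr}(\mathbf{\Phi}_{V,n}^\phi\mathbf{V})\le(V_n^{\max})^2$ for $n\in\mathcal{N}$, $\phi\in\mathcal{P}_n$; (f) $[\mathbf{V}]_{\mathcal{P}_0,\mathcal{P}_0}=\mathbf{v}_0\mathbf{v}_0^{\mathcal{H}}$; (g) $\mathbf{V}\succeq\mathbf{0}$. Areas. $\mathcal{N}$ is partitioned into areas $\mathcal{A}^{(1)},\dots,\mathcal{A}^{(L)}$. The extended area $\bar{\mathcal{A}}^{(l)}$ is $\mathcal{A}^{(l)}$ together with all nodes of other areas joined by a line to a node of $\mathcal{A}^{(l)}$. $\bar{\mathcal{N}}^{(l)}:=\{j\ne l:\bar{\mathcal{A}}^{(l)}\cap\bar{\mathcal{A}}^{(j)}\ne\emptyset\}$. $\mathbf{V}^{(l)}$ denotes a Hermitian matrix indexed by the (node, phase) pairs of $\bar{\mathcal{A}}^{(l)}$, and corresponds to the sub-matrix of $\mathbf{V}$ on these indices; superscript $l$ on a $\mathbf{\Phi}$-matrix denotes its sub-matrix on these indices. For $j\in\bar{\mathcal{N}}^{(l)}$, $\mathcal{P}_{lj}$ is the set of (node, phase) pairs of nodes in $\bar{\mathcal{A}}^{(l)}\cap\bar{\mathcal{A}}^{(j)}$, and $\mathbf{V}_j^{(l)}$ is the sub-matrix of $\mathbf{V}^{(l)}$ on rows and columns $\mathcal{P}_{lj}$. (As1) The graph $\mathcal{G}_{\mathcal{A}}$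 whose vertices are the areas and in which $l,j$ are adjacent iff $j\in\bar{\mathcal{N}}^{(l)}$ is a tree. (As2) $|\bar{\mathcal{A}}^{(l)}\setminus(\bar{\mathcal{A}}^{(l)}\cap\bar{\mathcal{A}}^{(i)})|>0$ for all $i\ne l$. $\mathcal{B}^{(l)}$ is the set of matrices $\mathbf{V}^{(l)}$ satisfying the constraints (a)–(e) with $\mathbf{\Phi}$ and $\mathbf{V}$ replaced by $\mathbf{\Phi}^{l}$ and $\mathbf{V}^{(l)}$, for the nodes $n\in\mathcal{A}^{(l)}$ only (i.e. (a),(b) for $n\in\mathcal{A}^{(l)}\setminus(\mathcal{S}\cup\{0\})$, (c),(d) for $s\in\mathcal{A}^{(l)}\cap\mathcal{S}$, (e) for $n\in\mathcal{A}^{(l)}$), plus constraint (f) on $\mathbf{V}^{(l)}$ for the area containing the PCC. $\tilde C_k^{(l)}(\mathbf{V}^{(l)})$ is the real-valued cost associated with area $l$, collecting the terms of $\tilde C_k$ pertaining to area $l$, so that $\tilde C_k(\mathbf{V})=\sum_l\tilde C_k^{(l)}(\mathbf{V}^{(l)})$ (up to an additive constant); for $k=1$, with $\mathbf{\Phi}^l_{m\leftrightarrow n}:=\mathbf{\Phi}^l_{m\to n}+\mathbf{\Phi}^l_{n\to m}$, it is the sum of $\mathrm{Tr}(\mathbf{\Phi}^l_{m\leftrightarrow n}\mathbf{V}^{(l)})$ over lines with both ends in $\mathcal{A}^{(l)}$ plus the sum of $\frac12\mathrm{Tr}(\mathbf{\Phi}^l_{m\leftrightarrow n}\mathbf{V}^{(l)})$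 over lines joining $m\in\mathcal{A}^{(l)}$ to $n\in\bar{\mathcal{A}}^{(l)}\setminus\mathcal{A}^{(l)}$; for $k=2$ the split into functions of $\mathbf{V}^{(l)}$, affine in $\mathbf{V}^{(l)}$, is not unique and any fixed one is used. Problem (P6). Minimize $\sum_l\tilde C_k^{(l)}(\mathbf{V}^{(l)})$ over $\{\mathbf{V}^{(l)}\succeq\mathbf{0}\}$ and real auxiliary matrices $\{\mathbf{W}_j^{(l)},\mathbf{X}_j^{(l)}\}_{j\in\bar{\mathcal{N}}^{(l)}}$ subject to $\mathbf{V}^{(l)}\in\mathcal{B}^{(l)}$, $\Re\{\mathbf{V}_j^{(l)}\}=\mathbf{W}_l^{(j)}$, $\Im\{\mathbf{V}_j^{(l)}\}=\mathbf{X}_l^{(j)}$, $\mathbf{W}_l^{(j)}=\mathbf{W}_j^{(l)}$, $\mathbf{X}_l^{(j)}=\mathbf{X}_j^{(l)}$ for all $l$ and $j\in\bar{\mathcal{N}}^{(l)}$. ADMM. For $\kappa>0$ and real multipliers $\mathbf{\Gamma}_j^{(l)},\mathbf{\Lambda}_j^{(l)}$ let $$\mathcal{L}=\sum_{l=1}^L\Big\{\tilde C_k^{(l)}(\mathbf{V}^{(l)})+\sum_{j\in\bar{\mathcal{N}}^{(l)}}\Big[\mathrm{Tr}((\mathbf{\Gamma}_j^{(l)})^{\mathcal{T}}(\Re\{\mathbf{V}_j^{(l)}\}-\mathbf{W}_l^{(j)}))+\mathrm{Tr}((\mathbf{\Lambda}_j^{(l)})^{\mathcal{T}}(\Im\{\mathbf{V}_j^{(l)}\}-\mathbf{X}_l^{(j)}))+\tfrac{\kappa}{2}\|\Re\{\mathbf{V}_j^{(l)}\}-\mathbf{W}_l^{(j)}\|_F^2+\tfrac{\kappa}{2}\|\Im\{\mathbf{V}_j^{(l)}\}-\mathbf{X}_l^{(j)}\|_F^2\Big]\Big\}.$$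 Iteration $i\to i+1$: [S1] $\{\mathbf{V}^{(l)}(i+1)\}$ minimizes $\mathcal{L}$ over $\{\mathbf{V}^{(l)}\succeq\mathbf{0},\ \mathbf{V}^{(l)}\in\mathcal{B}^{(l)}\}$ with $\mathbf{W},\mathbf{X},\mathbf{\Gamma},\mathbf{\Lambda}$ fixed at their values at iteration $i$; [S2] $\{\mathbf{W}_j^{(l)}(i+1),\mathbf{X}_j^{(l)}(i+1)\}$ minimizes $\mathcal{L}$ subject to $\mathbf{W}_l^{(j)}=\mathbf{W}_j^{(l)}$, $\mathbf{X}_l^{(j)}=\mathbf{X}_j^{(l)}$, with $\mathbf{V}^{(l)}=\mathbf{V}^{(l)}(i+1)$ and multipliers at iteration $i$; [S3] $\mathbf{\Gamma}_j^{(l)}(i+1)=\mathbf{\Gamma}_j^{(l)}(i)+\kappa(\Re\{\mathbf{V}_j^{(l)}(i+1)\}-\mathbf{W}_l^{(j)}(i+1))$ and $\mathbf{\Lambda}_j^{(l)}(i+1)=\mathbf{\Lambda}_j^{(l)}(i)+\kappa(\Im\{\mathbf{V}_j^{(l)}(i+1)\}-\mathbf{X}_l^{(j)}(i+1))$. The auxiliary variables are initialized consistently with the initial matrices: $\mathbf{W}_j^{(l)}(0)=\frac12\Re\{\mathbf{V}_j^{(l)}(0)+\mathbf{V}_l^{(j)}(0)\}$, $\mathbf{X}_j^{(l)}(0)=\frac12\Im\{\mathbf{V}_j^{(l)}(0)+\mathbf{V}_l^{(j)}(0)\}$.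
   Formalization: The convergence claim additionally assumes that (P6) admits Lagrange multipliers for its coupling constraints (a saddle point); without this the multipliers can fail to converge. ''The optimal solution'' of (P3) is read as unique on the extended areas. *)

(* Defs.v *)
(* MathComp world: MathComp 2.5, mathcomp-real-closed (complex numbers R[i])
   and MathComp-Analysis (realType, convergence of real sequences). *)
From HB Require Import structures.
From mathcomp Require Export all_boot all_order all_algebra.
From mathcomp Require Export spectral.
From mathcomp Require Export complex.
From mathcomp Require Export classical_sets reals topology normedtype sequences.
(* re-exported so that set0, setT, [disjoint _ & _] are those of finite sets *)
From mathcomp Require Export fintype finset.

Set Implicit Arguments.
Unset Strict Implicit.
Unset Printing Implicit Defensive.

Import Order.TTheory GRing.Theory Num.Theory.
Import numFieldNormedType.Exports.

Local Open Scope ring_scope.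
Local Open Scope complex_scope.
Local Open Scope sesquilinear_scope.

(** * Matrices indexed by subsets of a finite type

    A square matrix with rows and columns indexed by A : {set T} has type
    'M_#|A|; the i-th row is the one of [enum_val i]. *)

Section IndexedMatrices.
Variables (F : nmodType) (T : finType).

(* Entry (x, y) of M after zero-padding from A to the whole of T: the double
   sum has one term if x and y are both in A, and none otherwise. *)
Definition entry (A : {set T}) (M : 'M[F]_#|A|) (x y : T) : F :=
  \sum_(i < #|A| | enum_val i == x) \sum_(j < #|A| | enum_val j == y) M i j.

(* The matrix on index set B with the entries of M. For B \subset A this is the
   sub-matrix [M]_{B,B}; for B = A it is M itself, retyped when A and B are only
   provably equal. *)
Definition blk (A B : {set T}) (M : 'M[F]_#|A|) : 'M[F]_#|B| :=
  \matrix_(i, j) entry M (enum_val i) (enum_val j).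

End IndexedMatrices.

Arguments blk {F T A} B M.

Definition frobenius (R : rcfType) m n (M : 'M[R]_(m, n)) : R :=
  Num.sqrt (\sum_i \sum_j M i j ^+ 2).

Definition psd (C : numClosedFieldType) n (M : 'M[C]_n) : Prop :=
  M \is hermsymmx /\ forall x : 'cV[C]_n, 0 <= (x^t* *m M *m x) 0 0.

Definition real_nsd (R : realFieldType) n (M : 'M[R]_n) : Prop :=
  M^T = M /\ forall x : 'cV[R]_n, (x^T *m M *m x) 0 0 <= 0.

Definition reM (R : rcfType) m n (M : 'M[R[i]]_(m, n)) : 'M[R]_(m, n) :=
  map_mx (@complex.Re R) M.
Definition imM (R : rcfType) m n (M : 'M[R[i]]_(m, n)) : 'M[R]_(m, n) :=
  map_mx (@complex.Im R) M.

Definition mx_cvg (R : realType) m n (u : nat -> 'M[R]_(m, n))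
    (M : 'M[R]_(m, n)) : Prop :=
  forall a b, ((fun i => u i a b) @ \oo --> M a b)%classic.

Definition is_tree (T : finType) (e : rel T) : Prop :=
  [/\ symmetric e, irreflexive e, (forall x y, connect e x y)
    & forall c : seq T, ucycle e c -> (size c <= 2)%N].

(** * The network *)

Record network (R : realType) := Network {
  (* The nodes are 0, ..., nbus, node 0 being the point of common coupling; the
     phases a, b, c are 0, 1, 2. *)
  nbus : nat;
  lines : {set 'I_nbus.+1 * 'I_nbus.+1};
  lines_once : forall m n, (m, n) \in lines -> (n, m) \notin lines;
  phases : 'I_nbus.+1 -> {set 'I_3};
  phases_neq0 : forall n, phases n != set0;
  phases_pcc : phases ord0 = setT;
  lphases : 'I_nbus.+1 * 'I_nbus.+1 -> {set 'I_3};
  lphases_sub : forall e, e \in lines ->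
    lphases e \subset phases e.1 :&: phases e.2;
  Zline : forall e, 'M[R[i]]_#|lphases e|;
  Zline_unit : forall e, e \in lines -> Zline e \in unitmx;
  Yshunt : forall e, 'M[R[i]]_#|lphases e|;
  v0 : 'cV[R[i]]_3;
  DG : {set 'I_nbus.+1};
  DG_pcc : ord0 \notin DG;
  PL : 'I_nbus.+1 -> 'I_3 -> R;
  QL : 'I_nbus.+1 -> 'I_3 -> R;
  yC : 'I_nbus.+1 -> 'I_3 -> R;
  Vmin : 'I_nbus.+1 -> R;
  Vmax : 'I_nbus.+1 -> R;
  Vmin_ge0 : forall n, 0 <= Vmin n;
  Vmax_ge0 : forall n, 0 <= Vmax n;
  PGmin : 'I_nbus.+1 -> R;
  PGmax : 'I_nbus.+1 -> R;
  QGmin : 'I_nbus.+1 -> R;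
  QGmax : 'I_nbus.+1 -> R;
  cost : 'I_nbus.+1 -> R;
  cost_pcc : 0 < cost ord0;
  cost_ge0 : forall s, s \in DG -> 0 <= cost s
}.

Notation node G := ('I_(nbus G).+1).
Notation bus_phase G := ('I_(nbus G).+1 * 'I_3)%type.

(* The cases k = 1 and k = 2 of the cost. *)
Variant objective := Losses | Supply.

Section Network.
Variables (R : realType) (G : network R).

Definition adj (m n : node G) : bool :=
  ((m, n) \in lines G) || ((n, m) \in lines G).

(* The orientation in which the line joining m and n is listed. Line data are
   always read through [line], so that Z_mn = Z_nm and Y^(s)_mn = Y^(s)_nm. *)
Definition line (m n : node G) : node G * node G :=
  if (m, n) \in lines G then (m, n) else (n, m).

Definition busphases : {set bus_phase G} := [set x | x.2 \in phases x.1].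

Definition Ybus : 'M[R[i]]_#|busphases| :=
  \matrix_(i, j)
    let x := enum_val i in let y := enum_val j in
    if x.1 == y.1 then
      \sum_(m | adj x.1 m)
        (2^-1 * entry (Yshunt (line x.1 m)) x.2 y.2
         + entry (invmx (Zline (line x.1 m))) x.2 y.2)
    else if adj x.1 y.1 then - entry (invmx (Zline (line x.1 y.1))) x.2 y.2
    else 0.

Definition ebar (n : node G) (p : 'I_3) : 'cV[R[i]]_#|busphases| :=
  \col_i (enum_val i == (n, p))%:R.

Definition Ynp n p : 'M[R[i]]_#|busphases| := ebar n p *m (ebar n p)^T *m Ybus.
Definition PhiP n p : 'M[R[i]]_#|busphases| := 2^-1 *: (Ynp n p + (Ynp n p)^t*).
Definition PhiQ n p : 'M[R[i]]_#|busphases| := ('i%C / 2) *: (Ynp n p - (Ynp n p)^t*).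
Definition PhiV n p : 'M[R[i]]_#|busphases| := ebar n p *m (ebar n p)^T.

(* B_m, extracting from v the entries of v_m on the phases of line e. *)
Definition Bsel (e : node G * node G) (m : node G) :
    'M[R[i]]_(#|lphases e|, #|busphases|) :=
  \matrix_(i, j) (enum_val j == (m, enum_val i))%:R.

Definition Aflow (m n : node G) : 'M[R[i]]_(#|lphases (line m n)|, #|busphases|) :=
  invmx (Zline (line m n)) *m (Bsel (line m n) m - Bsel (line m n) n).

Definition PhiF (m n : node G) : 'M[R[i]]_#|busphases| :=
  2^-1 *: ((Aflow m n)^t* *m Bsel (line m n) m
           + (Bsel (line m n) m)^t* *m Aflow m n).

(* All traces below are of products of two Hermitian matrices, hence real. *)
Definition trR n (Phi V : 'M[R[i]]_n) : R := complex.Re (\tr (Phi *m V)).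

(** ** Problem (P3) *)

(* Constraints (a)-(e) at the nodes of D, where t Phi stands for Tr(Phi V). *)
Definition node_constraints (D : {set node G}) (t : 'M[R[i]]_#|busphases| -> R) : Prop :=
  [/\ forall n p, n \in D -> n \notin ord0 |: DG G -> p \in phases n ->
        t (PhiP n p) + PL n p = 0,
      forall n p, n \in D -> n \notin ord0 |: DG G -> p \in phases n ->
        t (PhiQ n p) + QL n p - yC n p * t (PhiV n p) = 0,
      forall s p, s \in D -> s \in DG G -> p \in phases s ->
        PGmin s <= t (PhiP s p) + PL s p <= PGmax s,
      forall s p, s \in D -> s \in DG G -> p \in phases s ->
        QGmin s <= t (PhiQ s p) + QL s p <= QGmax s
    & forall n p, n \in D -> p \in phases n ->
        Vmin n ^+ 2 <= t (PhiV n p) <= Vmax n ^+ 2].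

(* Constraint (f). *)
Definition pcc_constraint (A : {set bus_phase G}) (V : 'M[R[i]]_#|A|) : Prop :=
  \matrix_(p < 3, q < 3) entry V (ord0, p) (ord0, q) = v0 G *m (v0 G)^t*.

Definition P3_feasible (V : 'M[R[i]]_#|busphases|) : Prop :=
  [/\ node_constraints setT (fun Phi => trR Phi V), pcc_constraint V & psd V].

Definition C1 (V : 'M[R[i]]_#|busphases|) : R :=
  \sum_(e in lines G) (trR (PhiF e.1 e.2) V + trR (PhiF e.2 e.1) V).

Definition C2 (V : 'M[R[i]]_#|busphases|) : R :=
  \sum_(s in ord0 |: DG G) cost s * \sum_(p in phases s) trR (PhiP s p) V.

Definition Ck (k : objective) : 'M[R[i]]_#|busphases| -> R :=
  match k with Losses => C1 | Supply => C2 end.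

Definition P3_optimal (k : objective) (V : 'M[R[i]]_#|busphases|) : Prop :=
  P3_feasible V /\ forall U, P3_feasible U -> Ck k V <= Ck k U.

(** ** Areas *)

Definition area_partition (L : nat) (A : 'I_L -> {set node G}) : Prop :=
  [/\ forall l, A l != set0, forall l j, l != j -> [disjoint A l & A j]
    & \bigcup_l A l = setT].

Section Areas.
Variables (L : nat) (A : 'I_L -> {set node G}).

Definition Abar (l : 'I_L) : {set node G} :=
  A l :|: [set n | [exists m in A l, adj m n]].

Definition Nbar (l : 'I_L) : {set 'I_L} :=
  [set j | (j != l) && (Abar l :&: Abar j != set0)].

Definition As1 : Prop := is_tree (fun l j => j \in Nbar l).

Definition As2 : Prop :=
  forall l i, i != l -> (0 < #|Abar l :\: (Abar l :&: Abar i)|)%N.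

Definition ext (l : 'I_L) : {set bus_phase G} :=
  [set x in busphases | x.1 \in Abar l].

Definition Psh (l j : 'I_L) : {set bus_phase G} :=
  [set x in busphases | x.1 \in Abar l :&: Abar j].

Definition area_mats : Type := forall l : 'I_L, 'M[R[i]]_#|ext l|.
Definition pair_mats : Type := forall l j : 'I_L, 'M[R]_#|Psh l j|.

(* V_j^(l) and V_l^(j), both with rows and columns indexed by P_lj = P_jl. *)
Definition own (V : area_mats) (l j : 'I_L) : 'M[R[i]]_#|Psh l j| :=
  blk (Psh l j) (V l).
Definition other (V : area_mats) (l j : 'I_L) : 'M[R[i]]_#|Psh l j| :=
  blk (Psh l j) (V j).

(* If W l j is W_j^(l), then [swap W l j] is W_l^(j), indexed by P_lj = P_jl. *)
Definition swap (W : pair_mats) (l j : 'I_L) : 'M[R]_#|Psh l j| :=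
  blk (Psh l j) (W j l).

Definition inB (l : 'I_L) (V : 'M[R[i]]_#|ext l|) : Prop :=
  node_constraints (A l) (fun Phi => trR (blk (ext l) Phi) V)
  /\ (ord0 \in A l -> pcc_constraint V).

Definition C1loc (l : 'I_L) (V : 'M[R[i]]_#|ext l|) : R :=
  let t e := trR (blk (ext l) (PhiF e.1 e.2 + PhiF e.2 e.1)) V in
  \sum_(e in lines G | (e.1 \in A l) && (e.2 \in A l)) t e
  + \sum_(e in lines G | (e.1 \in A l) (+) (e.2 \in A l)) 2^-1 * t e.

(* f l is the share of area l in a splitting of C2 into functions of the V^(l),
   affine (over the reals) on Hermitian matrices. *)
Definition C2_split (f : forall l : 'I_L, 'M[R[i]]_#|ext l| -> R) : Prop :=
  (forall l (U V : 'M[R[i]]_#|ext l|) (t : R),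
     U \is hermsymmx -> V \is hermsymmx ->
     f l (t%:C *: U + (1 - t)%:C *: V) = t * f l U + (1 - t) * f l V)
  /\ exists c : R, forall V : 'M[R[i]]_#|busphases|, V \is hermsymmx ->
       C2 V = \sum_l f l (blk (ext l) V) + c.

Section Algorithms.
Variables (k : objective) (f : forall l : 'I_L, 'M[R[i]]_#|ext l| -> R).

Definition Cloc (l : 'I_L) : 'M[R[i]]_#|ext l| -> R :=
  match k with Losses => @C1loc l | Supply => @f l end.

(** ** Problem (P6) and its augmented Lagrangian *)

Definition V_domain (V : area_mats) : Prop :=
  forall l, psd (V l) /\ inB (V l).

Definition consensus (W X : pair_mats) : Prop :=
  forall l j, j \in Nbar l -> swap W l j = W l j /\ swap X l j = X l j.

Definition P6_feasible (V : area_mats) (W X : pair_mats) : Prop :=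
  [/\ V_domain V, consensus W X
    & forall l j, j \in Nbar l ->
        reM (own V l j) = swap W l j /\ imM (own V l j) = swap X l j].

Definition P6_optimal (V : area_mats) (W X : pair_mats) : Prop :=
  P6_feasible V W X /\
  forall V' W' X', P6_feasible V' W' X' ->
    \sum_l Cloc (V l) <= \sum_l Cloc (V' l).

(* For kappa = 0 this is the ordinary Lagrangian of (P6). *)
Definition Lagr (kappa : R) (V : area_mats) (W X Gam Lam : pair_mats) : R :=
  \sum_l (Cloc (V l) +
    \sum_(j in Nbar l)
      (\tr ((Gam l j)^T *m (reM (own V l j) - swap W l j))
       + \tr ((Lam l j)^T *m (imM (own V l j) - swap X l j))
       + kappa / 2 * frobenius (reM (own V l j) - swap W l j) ^+ 2
       + kappa / 2 * frobenius (imM (own V l j) - swap X l j) ^+ 2)).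

(* (Gam, Lam) are Lagrange multipliers of (P6) for the constraints coupling the
   V^(l) to (W, X): some optimal point also minimizes the ordinary Lagrangian.
   Without such multipliers the dual iterates cannot converge: a limit of the
   V^(l), Gam and Lam would provide them. *)
Definition P6_multipliers (Gam Lam : pair_mats) : Prop :=
  exists V W X, P6_optimal V W X /\
    forall V' W' X', V_domain V' -> consensus W' X' ->
      Lagr 0 V W X Gam Lam <= Lagr 0 V' W' X' Gam Lam.

(** ** ADMM. Primed arguments are the values at iteration i + 1. *)

Definition W_init (V0 : area_mats) (W0 X0 : pair_mats) : Prop :=
  forall l j, j \in Nbar l ->
    W0 l j = 2^-1 *: reM (own V0 l j + other V0 l j)
    /\ X0 l j = 2^-1 *: imM (own V0 l j + other V0 l j).

Definition S1 (kappa : R) (W X Gam Lam : pair_mats) (V' : area_mats) : Prop :=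
  V_domain V' /\
  forall U, V_domain U -> Lagr kappa V' W X Gam Lam <= Lagr kappa U W X Gam Lam.

Definition S2 (kappa : R) (V' : area_mats) (Gam Lam W' X' : pair_mats) : Prop :=
  consensus W' X' /\
  forall W X, consensus W X ->
    Lagr kappa V' W' X' Gam Lam <= Lagr kappa V' W X Gam Lam.

Definition S3 (kappa : R) (V' : area_mats)
    (W' X' Gam Lam Gam' Lam' : pair_mats) : Prop :=
  forall l j, j \in Nbar l ->
    Gam' l j = Gam l j + kappa *: (reM (own V' l j) - swap W' l j)
    /\ Lam' l j = Lam l j + kappa *: (imM (own V' l j) - swap X' l j).

(** ** The simplified updates *)

(* The matrix [-a, r^T; r, -I]. *)
Definition lmi n (a : R) (r : 'cV[R]_n) : 'M[R]_(1 + n) :=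
  block_mx (- a)%:M r^T r (- 1%:M).

(* V_j^(l) - 1/2 (V_j^(l)(i) + V_l^(j)(i)) for the candidate U of area l. *)
Definition deviation (V : area_mats) (l : 'I_L) (U : 'M[R[i]]_#|ext l|)
    (j : 'I_L) : 'M[R[i]]_#|Psh l j| :=
  blk (Psh l j) U - 2^-1 *: (own V l j + other V l j).

Definition P7_feasible (V : area_mats) (l : 'I_L)
    (U : 'M[R[i]]_#|ext l|) (a b : 'I_L -> R) : Prop :=
  [/\ psd U, inB U
    & forall j, j \in Nbar l ->
        [/\ 0 <= a j, 0 <= b j,
            real_nsd (lmi (a j) (mxvec (reM (deviation V U j)))^T)
          & real_nsd (lmi (b j) (mxvec (imM (deviation V U j)))^T)]].

Definition Lloc (kappa : R) (Gam Lam : pair_mats) (l : 'I_L)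
    (U : 'M[R[i]]_#|ext l|) (a b : 'I_L -> R) : R :=
  Cloc U
  + \sum_(j in Nbar l) kappa / 2 * (a j + b j)
  + \sum_(j in Nbar l)
      (\tr ((Gam l j)^T *m reM (blk (Psh l j) U))
       + \tr ((Lam l j)^T *m imM (blk (Psh l j) U))).

Definition S1' (kappa : R) (V : area_mats) (Gam Lam : pair_mats)
    (V' : area_mats) : Prop :=
  forall l, exists a b, P7_feasible V (V' l) a b /\
    forall (U : 'M[R[i]]_#|ext l|) a' b', P7_feasible V U a' b' ->
      Lloc kappa Gam Lam (V' l) a b <= Lloc kappa Gam Lam U a' b'.

Definition S2' (kappa : R) (V' : area_mats)
    (Gam Lam Gam' Lam' : pair_mats) : Prop :=
  forall l j, j \in Nbar l ->
    Gam' l j = Gam l j + (kappa / 2) *: (reM (own V' l j) - reM (other V' l j))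
    /\ Lam' l j =
         Lam l j + (kappa / 2) *: (imM (own V' l j) - imM (other V' l j)).

Definition zero_init (Gam Lam : nat -> pair_mats) : Prop :=
  forall l j, j \in Nbar l -> Gam 0%N l j = 0 /\ Lam 0%N l j = 0.

Definition admm_run (kappa : R) (V : nat -> area_mats)
    (W X Gam Lam : nat -> pair_mats) : Prop :=
  W_init (V 0%N) (W 0%N) (X 0%N) /\
  forall i, [/\ S1 kappa (W i) (X i) (Gam i) (Lam i) (V i.+1),
                S2 kappa (V i.+1) (Gam i) (Lam i) (W i.+1) (X i.+1)
              & S3 kappa (V i.+1) (W i.+1) (X i.+1)
                   (Gam i) (Lam i) (Gam i.+1) (Lam i.+1)].

Definition primal_dual_run (kappa : R) (V : nat -> area_mats)
    (Gam Lam : nat -> pair_mats) : Prop :=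
  forall i, S1' kappa (V i) (Gam i) (Lam i) (V i.+1)
         /\ S2' kappa (V i.+1) (Gam i) (Lam i) (Gam i.+1) (Lam i.+1).

End Algorithms.
End Areas.
End Network.

(* Main.v *)
(* (P6) is (P3) written area by area: since the areas form a tree, matrices V^(l) >= 0 that
   agree on overlaps are the sub-matrices of one matrix V >= 0, obtained by adding the areas
   one at a time, each new area meeting the previous ones only in one neighbour.

   With zero initial multipliers, those of the two copies of an overlap stay opposite, so [S2]
   is plain averaging; the Schur complement turns the constraints of (P7) into
   |r|^2 <= alpha_j, |r|^2 <= beta_j, which are tight at an optimum.

   Let z be the averaged overlaps, y the multipliers and (x_o, y_o) a saddle point with averaged
   overlaps z_o. The optimality condition of [S1] and the saddle inequality give that
   |y - y_o|^2 / kappa + kappa |z - z_o|^2 decreases at each step by at least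
   kappa (|V_overlap - z|^2 + |z' - z|^2). The iterates are therefore bounded and any of their
   limits along an ultrafilter is again a saddle point, hence a solution of (P6), hence made of
   the sub-matrices of V_opt; the decrease with respect to that limit itself gives the
   convergence of the multipliers. *)
Require Import Defs.
From mathcomp Require Import boolp ring lra.

Set Implicit Arguments.
Unset Strict Implicit.
Unset Printing Implicit Defensive.

Import Order.TTheory GRing.Theory Num.Theory.
Import numFieldNormedType.Exports.
Local Open Scope ring_scope.
Local Open Scope sesquilinear_scope.

(** * Convergence of the method of multipliers *)

(** The Lyapunov function sees only the overlaps and the multipliers. The other entries of the
    iterates stay bounded thanks to positive semidefiniteness and the voltage limits, and they
    converge because every limit is identified with the sub-matrices of the optimum. An ultrafilter
    gives limits to all coordinates at once, in place of successive extractions of subsequences.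
    Multipliers may fail to be unique, so their limit cannot be fixed in advance: it is read off
    along one ultrafilter. The convergence argument is carried out for real vectors, with a linear
    cost, a closed convex set and an involution exchanging the two copies of a shared coordinate.
    Families symmetric and antisymmetric under the involution are orthogonal, which removes the
    cross terms. Complex matrices of different sizes enter only through their coordinates. *)

Lemma cvg_sumr (R : realType) (T : Type) (F : set_system T) (FF : Filter F)
    (I : finType) (P : pred I) (u : I -> T -> R) (l : I -> R) :
  (forall i, P i -> (u i t @[t --> F] --> l i)%classic) ->
  (\sum_(i | P i) u i t @[t --> F] --> \sum_(i | P i) l i)%classic.
Proof.
move=> ul; elim: (index_enum I) => [|i s IH].
  by under eq_fun do rewrite big_nil; rewrite big_nil; exact: cvg_cst.
under eq_fun do rewrite big_cons; rewrite big_cons; case: ifP => // Pi.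
by apply: cvgD => //; exact: ul.
Qed.

(** The image of an ultrafilter is an ultrafilter, and this one contains the compact segment
    [-M, M]. *)
Lemma bounded_ultra_cvg (R : realType) (T : Type) (F : set_system T)
    (u : T -> R) (M : R) : UltraFilter F ->
  (forall t, `|u t| <= M) -> exists l : R, (u t @[t --> F] --> l)%classic.
Proof.
move=> UF uM.
have PF : ProperFilter F by exact: ultra_proper.
have UG : UltraFilter (u @ F)%classic.
  split; [exact: fmap_proper_filter|move=> H PH sub].
  apply/seteqP; split=> // B HB.
  have [//|FC] := in_ultra_setVsetC (u @^-1` B)%classic UF.
  have HC : H (~` B)%classic by exact: sub.
  by have [x []] := @filter_ex _ H _ (B `&` ~` B)%classic (filterI HB HC).
have := @segment_compact R (-M) M; rewrite compact_ultra => /(_ _ UG) UI.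
have [|l [_ ?]] := UI; last by exists l.
by apply: (@filterE _ F) => t; rewrite /= in_itv /= -ler_norml.
Qed.

(** If the preimage of a neighbourhood were not in [F], its complement could be added to [F], and an
    ultrafilter above the result would contain both. *)
Lemma cvg_of_ultra (R : realType) (T : Type) (F : set_system T)
    (u : T -> R) (l : R) : ProperFilter F ->
  (forall H, UltraFilter H -> (F `<=` H)%classic ->
     (u t @[t --> H] --> l)%classic) ->
  (u t @[t --> F] --> l)%classic.
Proof.
move=> PF ul B Bl; apply: contrapT => nFB.
pose N : set T := (~` (u @^-1` B))%classic.
have PW : ProperFilter (within N F).
  split; last exact: within_filter.
  move=> h; apply: nFB; move: h; rewrite /within /=.
  by apply: filterS => t /= h; apply: contrapT.
have [H [UH FH]] := ultraFilterLemma PW.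
have FsubH : (F `<=` H)%classic.
  by move=> C FC; apply: FH; rewrite /within /=; apply: filterS FC => t /=.
have HB : H (u @^-1` B)%classic by exact: (ul H UH FsubH B Bl).
have HN : H N by apply: FH; rewrite /within /=; apply: filterE => t.
have PH : ProperFilter H by exact: ultra_proper.
by have [x [? []]] := @filter_ex _ H _ _ (filterI HB HN).
Qed.

(** Extracts a first-order condition: [a] is a slope and [t * b] the quadratic remainder divided by
    [t]. *)
Lemma ge0_of_small_perturbation (R : realFieldType) (a b : R) :
  (forall t, 0 < t <= 1 -> 0 <= a + t * b) -> 0 <= a.
Proof.
move=> h; rewrite leNgt; apply/negP => a0.
have N0 : 0 < `|b| - a by rewrite subr_gt0 (lt_le_trans a0).
have b0 := ler_norm b.
(* If a < 0, this step length keeps t |b| below -a / 2, so a + t b is still negative. *)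
have /h : 0 < - a / (2 * (`|b| - a)) <= 1.
  rewrite divr_gt0 ?oppr_gt0 ?mulr_gt0 //= ler_pdivrMr ?mulr_gt0 // mul1r.
  by have := normr_ge0 b; lra.
have -> : a + - a / (2 * (`|b| - a)) * b = (a * (2 * (`|b| - a) - b)) / (2 * (`|b| - a)).
  by field; rewrite gt_eqF.
rewrite pmulr_lge0 ?invr_gt0 ?mulr_gt0 // nmulr_rge0 //.
by have := normr_ge0 b; lra.
Qed.

(** * ADMM for a linear cost, with consensus along an involution *)

Section ADMM.
Variables (R : realType) (K J : finType) (Q : pred J) (e : J -> K) (s : J -> J).
Hypotheses (sK : involutive s) (Qs : forall j, Q (s j) = Q j).

Definition involution_avg (u : J -> R) (j : J) : R := 2^-1 * (u j + u (s j)).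
Local Notation avg := involution_avg.

Definition s_sym (u : J -> R) := forall j, Q j -> u (s j) = u j.
Definition s_anti (u : J -> R) := forall j, Q j -> u (s j) = - u j.

(** Reindexing along [s] changes the sign of the sum. This orthogonality removes the cross terms of
    the convergence proof. *)
Lemma sum_sym_anti (u v : J -> R) : s_sym u -> s_anti v ->
  \sum_(j | Q j) u j * v j = 0.
Proof.
move=> us va; set S := LHS; suff: S = - S by move/eqP; rewrite -addr_eq0 -mulr2n mulrn_eq0 => /eqP.
rewrite {1}/S (reindex_inj (inv_inj sK)) /= -sumrN.
by under eq_bigl do rewrite Qs; apply: eq_bigr => j Qj; rewrite us // va // mulrN.
Qed.

Lemma avg_sym u : s_sym (avg u).
Proof. by move=> j Qj; rewrite /avg sK addrC. Qed.

Lemma sub_avg_anti u : s_anti (fun j => u j - avg u j).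
Proof. by move=> j Qj; rewrite /avg sK; field. Qed.

Definition aug (kap : R) (y w v : J -> R) : R :=
  \sum_(j | Q j) (y j * (v j - w j) + kap / 2 * (v j - w j) ^+ 2).

Lemma aug_sym_minimizer (kap : R) (y w v : J -> R) : 0 < kap -> s_anti y ->
  s_sym w ->
  (forall w', s_sym w' -> aug kap y w v <= aug kap y w' v) <->
  (forall j, Q j -> w j = avg v j).
Proof.
move=> k0 ya ws.
(* The terms linear in avg v - w', a symmetric family, pair it with y and with v - avg v, both
   antisymmetric; only the square remains. *)
have augE w' : s_sym w' -> aug kap y w' v =
    aug kap y (avg v) v + kap / 2 * \sum_(j | Q j) (w' j - avg v j) ^+ 2.
  move=> w's; pose d j := avg v j - w' j.
  have ds : s_sym d by move=> j Qj; rewrite /d avg_sym // w's.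
  have E : aug kap y w' v = aug kap y (avg v) v
      + kap / 2 * \sum_(j | Q j) (w' j - avg v j) ^+ 2
      + \sum_(j | Q j) d j * y j
      + kap * \sum_(j | Q j) d j * (v j - avg v j).
    rewrite /aug !mulr_sumr -!big_split /=; apply: eq_bigr => j Qj; rewrite /d.
    by field.
  by rewrite E (sum_sym_anti ds ya) (sum_sym_anti ds (sub_avg_anti v)) mulr0 !addr0.
have sq0 w' : 0 <= \sum_(j | Q j) (w' j - avg v j) ^+ 2.
  by apply: sumr_ge0 => j _; exact: sqr_ge0.
split=> [/(_ (avg v) (@avg_sym v))|wE w' w's].
  rewrite augE // gerDl pmulr_rle0 ?divr_gt0 // => le0 j Qj; apply/eqP.
  rewrite -subr_eq0 -sqrf_eq0; have /eqP : \sum_(j | Q j) (w j - avg v j) ^+ 2 = 0.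
    by apply/eqP; rewrite eq_le le0 sq0.
  by rewrite psumr_eq0 => [/allP/(_ j)|i _]; rewrite ?mem_index_enum ?Qj ?sqr_ge0 //= => ->.
rewrite (augE _ ws) (augE _ w's) lerD2l ler_pM2l ?divr_gt0 // [leLHS]big1 //.
by move=> j Qj; rewrite wE // subrr expr0n.
Qed.

Variables (D : (K -> R) -> Prop) (c : K -> R).
Hypothesis D_convex : forall x z (t : R), 0 <= t <= 1 -> D x -> D z ->
  D (fun k => z k + t * (x k - z k)).

Definition lin_cost (x : K -> R) := \sum_k c k * x k.
Local Notation cost := lin_cost.

Definition aug_argmin (kap : R) (y w : J -> R) (x : K -> R) :=
  D x /\ forall z, D z ->
    cost x + aug kap y w (x \o e) <= cost z + aug kap y w (z \o e).

(** Along the segment from [x] to [z] the objective is a quadratic polynomial in [t], least at t = 0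
    on [0, 1]; the claim is that its slope there is nonnegative. *)
Lemma aug_argmin_vi kap y w x z : aug_argmin kap y w x -> D z ->
  0 <= cost z - cost x
       + \sum_(j | Q j) (y j + kap * (x (e j) - w j)) * (z (e j) - x (e j)).
Proof.
move=> [Dx xmin] Dz; set S := \sum_(j | _) _.
pose N := kap / 2 * \sum_(j | Q j) (z (e j) - x (e j)) ^+ 2.
apply: (@ge0_of_small_perturbation _ _ N) => t /andP[t0 t1].
have /xmin : D (fun k => x k + t * (z k - x k)) by apply: D_convex; rewrite ?(ltW t0).
have -> : cost (fun k => x k + t * (z k - x k)) = cost x + t * (cost z - cost x).
  rewrite /cost -sumrB !mulr_sumr -big_split /=; apply: eq_bigr => k _; ring.
have -> : aug kap y w ((fun k => x k + t * (z k - x k)) \o e) =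
    aug kap y w (x \o e) + t * S + t ^+ 2 * N.
  rewrite /aug /S /N !mulr_sumr -!big_split /=; apply: eq_bigr => j _; by field.
move=> h; rewrite -(pmulr_rge0 _ t0); lra.
Qed.

(* Saddle point of the Lagrangian of: minimize [cost] over the points of [D] whose coordinates
   [e j] and [e (s j)] agree. The multipliers of the two constraints [x (e j) = w j] and
   [x (e (s j)) = w j] are opposite because [w] is free. *)
Definition saddle (x : K -> R) (y : J -> R) :=
  [/\ D x, s_sym (x \o e), s_anti y & forall z, D z ->
    0 <= cost z - cost x + \sum_(j | Q j) y j * (z (e j) - x (e j))].

Variables (kap : R) (x : nat -> K -> R) (y : nat -> J -> R).
Hypothesis kap_gt0 : 0 < kap.
Let w i := avg (x i \o e).
Let r i j := x i (e j) - w i j.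
Hypothesis y0 : forall j, Q j -> y 0%N j = 0.
Hypothesis xS : forall i, aug_argmin kap (y i) (w i) (x i.+1).
Hypothesis yS : forall i j, Q j ->
  y i.+1 j = y i j + kap / 2 * (x i.+1 (e j) - x i.+1 (e (s j))).

Let ySr i j : Q j -> y i.+1 j = y i j + kap * r i.+1 j.
Proof. by move=> Qj; rewrite yS // /r /w /avg /=; field. Qed.

Let y_anti i : s_anti (y i).
Proof.
elim: i => [|i IH] j Qj; first by rewrite !y0 ?Qs ?oppr0.
by rewrite !yS ?Qs // sK IH //; field.
Qed.

(** The multiplier update absorbs the gradient of the penalty: y_i + kap (x_{i+1} - w_i) equals
    y_{i+1} + kap (w_{i+1} - w_i). What is left over is the drift of the averages. *)
Let vi i z : D z -> 0 <= cost z - cost (x i.+1)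
  + \sum_(j | Q j) (y i.+1 j + kap * (w i.+1 j - w i j)) * (z (e j) - x i.+1 (e j)).
Proof.
move=> Dz; have := aug_argmin_vi (xS i) Dz; congr (0 <= _ + _).
by apply: eq_bigr => j Qj; rewrite ySr // /r; congr (_ * _); ring.
Qed.

Definition lyapunov (xo : K -> R) (yo : J -> R) i : R :=
  \sum_(j | Q j) (kap^-1 * (y i j - yo j) ^+ 2 + kap * (w i j - xo (e j)) ^+ 2).

Lemma lyapunov_decrease xo yo i : saddle xo yo ->
  lyapunov xo yo i.+1
  + kap * \sum_(j | Q j) (r i.+1 j ^+ 2 + (w i.+1 j - w i j) ^+ 2)
  <= lyapunov xo yo i.
Proof.
move=> [Dxo xos yoa xomin].
(* The saddle inequality is tested at the iterate, and the optimality condition of the iterate at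
   the saddle point; in their sum the costs cancel. *)
have Dx := (xS i).1; have h1 := xomin _ Dx; have h2 := vi i Dxo.
have rs := sub_avg_anti (x i.+1 \o e).
(* In both cross terms a symmetric family of averages meets an antisymmetric one, of multipliers or
   of residuals. *)
have E1 : \sum_(j | Q j) (w i.+1 j - xo (e j)) * (y i.+1 j - yo j) = 0.
  apply: sum_sym_anti => j Qj; first by rewrite /w avg_sym //; have /= -> := xos j Qj.
  by rewrite y_anti // yoa //; ring.
have E2 : \sum_(j | Q j) (w i.+1 j - w i j) * r i.+1 j = 0.
  by apply: sum_sym_anti => // j Qj; rewrite /w !avg_sym.
(* Expanding the squares, the drop of the Lyapunov function is the claimed decrease, plus twice the
   sum of the two inequalities, plus the vanishing cross terms. *)
suff -> : lyapunov xo yo i = lyapunov xo yo i.+1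
    + kap * \sum_(j | Q j) (r i.+1 j ^+ 2 + (w i.+1 j - w i j) ^+ 2)
    + 2 * (cost xo - cost (x i.+1)
      + \sum_(j | Q j) (y i.+1 j + kap * (w i.+1 j - w i j)) * (xo (e j) - x i.+1 (e j))
      + (cost (x i.+1) - cost xo
         + \sum_(j | Q j) yo j * (x i.+1 (e j) - xo (e j))))
    + 2 * (\sum_(j | Q j) (w i.+1 j - xo (e j)) * (y i.+1 j - yo j))
    + 2 * kap * \sum_(j | Q j) (w i.+1 j - w i j) * r i.+1 j.
  by rewrite E1 E2 !mulr0 !addr0 lerDl mulr_ge0 // addr_ge0.
set C := cost xo; set C' := cost (x i.+1).
have -> : forall a b, C - C' + a + (C' - C + b) = a + b by move=> a b; ring.
rewrite /lyapunov !mulr_sumr -!big_split mulr_sumr -!big_split /=; apply: eq_bigr => j Qj.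
have -> : y i j = y i.+1 j - kap * r i.+1 j by rewrite ySr //; ring.
by rewrite /r; field; rewrite gt_eqF.
Qed.

Let sq_ge0 (a u : R) : 0 < a -> 0 <= a * u ^+ 2.
Proof. by move=> a0; apply: mulr_ge0; rewrite ?sqr_ge0 ?ltW. Qed.

Lemma lyapunov_ge0 xo yo i : 0 <= lyapunov xo yo i.
Proof.
apply: sumr_ge0 => j _.
by rewrite addr_ge0 ?sq_ge0 ?invr_gt0.
Qed.

Lemma lyapunov_term xo yo i j : Q j ->
  kap^-1 * (y i j - yo j) ^+ 2 + kap * (w i j - xo (e j)) ^+ 2 <= lyapunov xo yo i.
Proof.
move=> Qj; rewrite /lyapunov (bigD1 j) //= lerDl; apply: sumr_ge0 => {Qj}j _.
by rewrite addr_ge0 ?sq_ge0 ?invr_gt0.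
Qed.

Lemma lyapunov_residual xo yo i j : saddle xo yo -> Q j ->
  kap * (r i.+1 j ^+ 2 + (w i.+1 j - w i j) ^+ 2)
    <= lyapunov xo yo i - lyapunov xo yo i.+1.
Proof.
move=> sad Qj; have := lyapunov_decrease i sad.
rewrite (bigD1 j) //= mulrDr; set T := \sum_(_ | _) _.
have : 0 <= kap * T.
  by rewrite mulr_ge0 ?(ltW kap_gt0)//; apply: sumr_ge0 => *; rewrite addr_ge0 ?sqr_ge0.
lra.
Qed.

Lemma lyapunov_nonincreasing xo yo : saddle xo yo ->
  {homo lyapunov xo yo : n m / (n <= m)%N >-> m <= n}.
Proof.
move=> sad; apply/nonincreasing_seqP => i; have := lyapunov_decrease i sad; apply: le_trans.
rewrite lerDl mulr_ge0 ?(ltW kap_gt0)//.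
by apply: sumr_ge0 => *; rewrite addr_ge0 ?sqr_ge0.
Qed.

Lemma lyapunov_cvg xo yo : saddle xo yo ->
  exists l : R, (lyapunov xo yo i @[i --> \oo] --> l)%classic.
Proof.
move=> sad; have cv : (cvgn (lyapunov xo yo))%classic.
  apply: nonincreasing_is_cvgn; first exact: lyapunov_nonincreasing.
  by exists 0 => _ [i _ <-]; exact: lyapunov_ge0.
by exists (limn (lyapunov xo yo)).
Qed.

Lemma sqr_squeeze (T : Type) (F : set_system T) (FF : Filter F) (a b : R) (u v : T -> R) :
  0 < a -> (forall t, a * (u t - b) ^+ 2 <= v t) ->
  (v t @[t --> F] --> 0)%classic -> (u t @[t --> F] --> b)%classic.
Proof.
move=> a0 uv v0; apply/cvgrPdist_lt => eps eps0.
move/cvgrPdist_lt: v0 => /(_ _ (mulr_gt0 a0 (exprn_gt0 2 eps0))).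
apply: filterS => t; rewrite sub0r normrN => vt.
have : a * (u t - b) ^+ 2 < a * eps ^+ 2 by apply: le_lt_trans (le_lt_trans (ler_norm _) vt).
rewrite ltr_pM2l // -real_normK ?num_real // ltr_pXn2r // ?nnegrE ?(ltW eps0) //.
by rewrite distrC.
Qed.

Lemma residual_cvg0 xo yo j : saddle xo yo -> Q j ->
  (r i.+1 j @[i --> \oo] --> 0)%classic /\
  (w i.+1 j - w i j @[i --> \oo] --> 0)%classic.
Proof.
move=> sad Qj; have [l cv] := lyapunov_cvg sad.
have dcv : (lyapunov xo yo i - lyapunov xo yo i.+1 @[i --> \oo] --> 0)%classic.
  by rewrite -(subrr l); apply: cvgB => //; rewrite (cvg_shiftS (lyapunov xo yo)).
split; apply: (sqr_squeeze _ kap_gt0 _ dcv) => i; rewrite subr0;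
  apply: le_trans (lyapunov_residual i sad Qj); rewrite mulrDr ?lerDl ?lerDr;
  by rewrite sq_ge0.
Qed.

(** Closedness is stated along proper filters because limits are taken along ultrafilters. *)
Hypothesis D_closed : forall (F : set_system nat) (u : nat -> K -> R) (v : K -> R),
  ProperFilter F -> (forall i, D (u i)) ->
  (forall k, (u i k @[i --> F] --> v k)%classic) -> D v.
(** Carries a bound from the shared coordinates, the only ones that the Lyapunov function controls,
    to all coordinates. *)
Hypothesis D_bounded : forall M : R, exists M' : R, forall z, D z ->
  (forall j, Q j -> `|z (e j)| <= M) -> forall k, `|z k| <= M'.

Lemma norm_le_sqr (u : R) : `|u| <= 1 + u ^+ 2.
Proof. by rewrite -real_normK ?num_real //; have := sqr_ge0 (`|u| - 1); nra. Qed.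

(** A shared coordinate of the iterate is its residual, plus the deviation of the average from the
    saddle point, plus the saddle point; the Lyapunov function controls the first two. The index of
    [x] starts at 1 because [x 0] is not assumed to lie in [D]. *)
Lemma iterates_bounded xo yo : saddle xo yo -> exists M,
  (forall i k, `|x i.+1 k| <= M) /\ (forall i j, Q j -> `|y i j| <= M).
Proof.
move=> sad; pose B := lyapunov xo yo 0.
have B0 : 0 <= B by exact: lyapunov_ge0.
have LB i : lyapunov xo yo i <= B by exact: (lyapunov_nonincreasing sad (leq0n i)).
have sqb (b u : R) : 0 < b -> b * u ^+ 2 <= B -> `|u| <= 1 + B / b.
  move=> b0 h; apply: le_trans (norm_le_sqr u) _.
  by rewrite lerD2l ler_pdivlMr // mulrC.
have wb i j : Q j -> `|w i j - xo (e j)| <= 1 + B / kap.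
  move=> Qj; apply: sqb => //; apply: le_trans (LB i).
  by apply: le_trans (lyapunov_term xo yo i Qj); rewrite lerDr sq_ge0 ?invr_gt0.
have rb i j : Q j -> `|r i.+1 j| <= 1 + B / kap.
  move=> Qj; apply: sqb => //; apply: le_trans (LB i).
  have := lyapunov_residual i sad Qj; have := lyapunov_ge0 xo yo i.+1.
  have := sq_ge0 (w i.+1 j - w i j) kap_gt0.
  lra.
have yb i j : Q j -> `|y i j - yo j| <= 1 + B / kap^-1.
  move=> Qj; apply: sqb; rewrite ?invr_gt0 //; apply: le_trans (LB i).
  apply: le_trans (lyapunov_term xo yo i Qj).
  by rewrite lerDl sq_ge0.
have [M' M'P] := D_bounded (2 * (1 + B / kap) + \sum_j `|xo (e j)|).
have sumb (v : J -> R) j : `|v j| <= \sum_j `|v j|.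
  by rewrite (bigD1 j) //= lerDl sumr_ge0.
exists (`|M'| + (1 + B / kap^-1) + \sum_j `|yo j|); split=> [i k|i j Qj].
  have h : `|x i.+1 k| <= M'.
    apply: M'P => [|j Qj]; first exact: (xS i).1.
    have -> : x i.+1 (e j) = r i.+1 j + (w i.+1 j - xo (e j)) + xo (e j) by rewrite /r; ring.
    apply: le_trans (ler_normD _ _) _.
    apply: lerD (sumb (xo \o e) j).
    apply: le_trans (ler_normD _ _) _.
    by have := rb i j Qj; have := wb i.+1 j Qj; lra.
  have : 0 <= \sum_j `|yo j| by apply: sumr_ge0.
  have : 0 <= B / kap^-1 by rewrite divr_ge0 ?invr_ge0 ?(ltW kap_gt0).
  have := ler_norm M'; lra.
have -> : y i j = (y i j - yo j) + yo j by ring.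
apply: le_trans (ler_normD _ _) _; apply: lerD (sumb _ j).
by have := yb i j Qj; have := normr_ge0 M'; lra.
Qed.

Variable xopt : K -> R.
Hypothesis xopt_unique : forall v, D v -> s_sym (v \o e) ->
  (forall z, D z -> s_sym (z \o e) -> cost v <= cost z) -> v =1 xopt.

(** Passing to the limit in [vi], where the drift of the averages vanishes, gives the saddle
    inequality. The primal limit is then a constrained minimizer, hence [xopt]; the dual limit may a
    priori depend on the ultrafilter. *)
Lemma iterates_ultra_limit xo yo (F : set_system nat) : saddle xo yo ->
  UltraFilter F -> (\oo `<=` F)%classic ->
  exists yoo, [/\ saddle xopt yoo, forall k, (x i.+1 k @[i --> F] --> xopt k)%classic
    & forall j, Q j -> (y i.+1 j @[i --> F] --> yoo j)%classic].
Proof.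
move=> sad UF ooF; have PF : ProperFilter F by exact: ultra_proper.
have toF (u : nat -> R) (l : R) : (u i @[i --> \oo] --> l)%classic ->
    (u i @[i --> F] --> l)%classic.
  by move=> ul B /ul; exact: ooF.
have [M [xM yM]] := iterates_bounded sad.
have /choice [v xv] : forall k, exists l : R, (x i.+1 k @[i --> F] --> l)%classic.
  by move=> k; apply: (@bounded_ultra_cvg _ _ _ _ M) => i; exact: xM.
have /choice [yoo yy] : forall j, exists l : R, Q j -> (y i.+1 j @[i --> F] --> l)%classic.
  move=> j; have [Qj|nQj] := boolP (Q j); last by exists 0.
  by have [i|l ?] := @bounded_ultra_cvg _ _ _ (fun i => y i.+1 j) M UF; [exact: yM|exists l].
have wv j : (w i.+1 j @[i --> F] --> avg (v \o e) j)%classic.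
  by rewrite /w /avg /=; apply: cvgM; [exact: cvg_cst|exact: cvgD].
have Dv : D v by apply: (D_closed PF _ xv) => i; exact: (xS i).1.
have vsym : s_sym (v \o e).
  (* A vanishing residual makes each shared coordinate of the limit equal to the average of its two
     copies. *)
  have vavg j : Q j -> v (e j) = avg (v \o e) j.
    move=> Qj; apply/eqP; rewrite -subr_eq0; apply/eqP.
    have [/toF r0 _] := residual_cvg0 sad Qj.
    apply: (cvg_unique _ _ r0) => //; exact: cvgB.
  by move=> j Qj /=; rewrite !vavg ?Qs // avg_sym.
have ysym : s_anti yoo.
  move=> j Qj; apply: (cvg_unique _ (yy _ _)) => //; first by rewrite Qs.
  have -> : (fun i => y i.+1 (s j)) = (fun i => - y i.+1 j).
    by apply/funext => i; rewrite y_anti.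
  by apply: cvgN; exact: yy.
have cost_cvg : (cost (x i.+1) @[i --> F] --> cost v)%classic.
  by apply: cvg_sumr => k _; apply: cvgM => //; exact: cvg_cst.
have vmin z : D z -> 0 <= cost z - cost v + \sum_(j | Q j) yoo j * (z (e j) - v (e j)).
  move=> Dz; set l := (X in 0 <= X).
  have hl : (cost z - cost (x i.+1)
      + \sum_(j | Q j) (y i.+1 j + kap * (w i.+1 j - w i j)) * (z (e j) - x i.+1 (e j))
      @[i --> F] --> l)%classic.
    apply: cvgD; first by apply: cvgB => //; exact: cvg_cst.
    apply: cvg_sumr => j Qj; apply: cvgM; last by apply: cvgB => //; exact: cvg_cst.
    rewrite -[yoo j]addr0; apply: cvgD; first exact: yy.
    rewrite -(mulr0 kap); apply: cvgM; first exact: cvg_cst.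
    by have [_ /toF] := residual_cvg0 sad Qj.
  rewrite -(cvg_lim _ hl) //; apply: limr_ge; first by apply/cvg_ex; exists l.
  by apply: filterE => i; exact: vi.
have vE : v = xopt.
  apply/funext; apply: xopt_unique => // z Dz zsym.
  (* When the copies of z agree, the multiplier term pairs a symmetric family with an antisymmetric
     one, so only the costs remain. *)
  have := vmin z Dz; suff -> : \sum_(j | Q j) yoo j * (z (e j) - v (e j)) = 0.
    by rewrite addr0 subr_ge0.
  under eq_bigr do rewrite mulrC; apply: sum_sym_anti => // j Qj.
  by have /= -> := zsym j Qj; have /= -> := vsym j Qj.
by exists yoo; split=> [|k|j Qj]; [split|rewrite -vE|exact: yy]; rewrite -?vE.
Qed.

Theorem admm_cvg xo yo : saddle xo yo ->
  (forall k, (x i k @[i --> \oo] --> xopt k)%classic) /\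
  exists yoo : J -> R, forall j, Q j -> (y i j @[i --> \oo] --> yoo j)%classic.
Proof.
move=> sad; split=> [k|].
  rewrite -(cvg_shiftS (fun i => x i k)); apply: cvg_of_ultra => F UF ooF.
  by have [? []] := iterates_ultra_limit sad UF ooF.
(* Any ultrafilter at infinity provides a saddle point [(xopt, yoo)]. Relative to it the Lyapunov
   function converges along the integers, and the limit must be 0 because it is 0 along the
   ultrafilter. *)
have [F [UF ooF]] := ultraFilterLemma (F := (\oo)%classic) _.
have [yoo [sado xF yF]] := iterates_ultra_limit sad UF ooF.
exists yoo => j Qj; have [l cv] := lyapunov_cvg sado.
have PF : ProperFilter F by exact: ultra_proper.
suff l0 : l = 0.
  apply: (sqr_squeeze _ (a := kap^-1) _ (v := lyapunov xopt yoo)); rewrite ?invr_gt0 //.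
    by move=> i; apply: le_trans (lyapunov_term xopt yoo i Qj); rewrite lerDl sq_ge0.
  by rewrite -l0.
have cvF : (lyapunov xopt yoo i.+1 @[i --> F] --> l)%classic.
  by move: cv; rewrite -(cvg_shiftS (lyapunov xopt yoo)) => cv B /cv; exact: ooF.
apply: (cvg_unique _ cvF) => //.
have -> : 0 = \sum_(j | Q j) (kap^-1 * (yoo j - yoo j) ^+ 2
    + kap * (avg (xopt \o e) j - xopt (e j)) ^+ 2).
  rewrite big1 // => i Qi; have [_ xs _ _] := sado.
  have -> : avg (xopt \o e) i = xopt (e i) by rewrite /avg (xs i Qi) /=; field.
  by rewrite !subrr expr0n !mulr0 addr0.
apply: cvg_sumr => i Qi; apply: cvgD; (apply: cvgM; first exact: cvg_cst).
  rewrite expr2; under eq_fun do rewrite expr2.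
  by apply: cvgM; apply: cvgB; (exact: yF || exact: cvg_cst).
have wc : (w i0.+1 i @[i0 --> F] --> avg (xopt \o e) i)%classic.
  by rewrite /w /avg /=; apply: cvgM; [exact: cvg_cst|exact: cvgD].
rewrite expr2; under eq_fun do rewrite expr2.
by apply: cvgM; apply: cvgB => //; exact: cvg_cst.
Qed.

End ADMM.

(** * Positive semidefinite completion over a tree *)

Section PSD.
Variable C : numClosedFieldType.

Lemma trmxC_mul m n p (M : 'M[C]_(m, n)) (N : 'M[C]_(n, p)) :
  (M *m N)^t* = N^t* *m M^t*.
Proof. by rewrite trmx_mul map_mxM. Qed.

Lemma trmxCD m n (M N : 'M[C]_(m, n)) : (M + N)^t* = M^t* + N^t*.
Proof. by rewrite linearD map_mxD. Qed.

Lemma hermsymmxE n (M : 'M[C]_n) : (M \is hermsymmx) = (M == M^t*).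
Proof. by rewrite is_hermitianmxE expr0 scale1r. Qed.

Lemma psd_herm n (M : 'M[C]_n) : psd M -> M^t* = M.
Proof. by case; rewrite hermsymmxE => /eqP. Qed.

Lemma psd_congr m n (M : 'M[C]_m) (P : 'M[C]_(m, n)) :
  psd M -> psd (P^t* *m M *m P).
Proof.
move=> psdM; split.
  by rewrite hermsymmxE !trmxC_mul trmxCK psd_herm // mulmxA.
move=> x; have := psdM.2 (P *m x); by rewrite trmxC_mul !mulmxA.
Qed.

Lemma psd_add n (M N : 'M[C]_n) : psd M -> psd N -> psd (M + N).
Proof.
move=> pM pN; split; first by rewrite hermsymmxE trmxCD !psd_herm.
by move=> x; rewrite mulmxDr mulmxDl mxE addr_ge0 ?pM.2 ?pN.2.
Qed.

Lemma form_eq0 n (u : 'cV[C]_n) : (u^t* *m u) 0 0 = 0 -> u = 0.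
Proof.
rewrite mxE => /eqP; rewrite psumr_eq0 => [/allP h|i _]; last first.
  by rewrite !mxE mulrC mul_conjC_ge0.
apply/colP => i; have /= := h i (mem_index_enum _).
by rewrite !mxE mulrC mul_conjC_eq0 => /eqP.
Qed.

Lemma form_ge0 n (u : 'cV[C]_n) : 0 <= (u^t* *m u) 0 0.
Proof. by rewrite mxE sumr_ge0 // => i _; rewrite !mxE mulrC mul_conjC_ge0. Qed.

(** If u = H x were nonzero, the form at x - t u would be t (t q - 2 |u|^2), with q the form at u:
    negative for small t > 0. *)
Lemma psd_form_eq0 n (H : 'M[C]_n) (x : 'cV[C]_n) : psd H ->
  (x^t* *m H *m x) 0 0 = 0 -> H *m x = 0.
Proof.
move=> psdH x0; apply: form_eq0; apply/eqP; apply: contraT => n0.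
set u := H *m x in n0; pose q := (u^t* *m H *m u) 0 0; pose nn := (u^t* *m u) 0 0.
have nn0 : 0 < nn by rewrite lt_def n0 form_ge0.
have q0 : 0 <= q by exact: psdH.2.
have uE : u^t* = x^t* *m H by rewrite trmxC_mul psd_herm.
(* The denominator is positive even when q = 0, and t q = |u|^2 - t is below 2 |u|^2. *)
pose t := nn / (q + 1); have q1 : 0 < q + 1 by rewrite ltr_wpDl.
have t0 : 0 < t by rewrite divr_gt0.
have tr : t^* = t by apply: conj_Creal; rewrite realE ltW.
have := psdH.2 (x - t *: u).
have -> : ((x - t *: u)^t* *m H *m (x - t *: u)) 0 0 = t * (t * q - 2 * nn).
  have -> : (x - t *: u)^t* = x^t* - t *: u^t*.
    by apply/matrixP => i j; rewrite !mxE rmorphB rmorphM /= tr.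
  rewrite !(mulmxBl, mulmxBr) -!scalemxAr -!scalemxAl -uE.
  rewrite -[u^t* *m H *m x]mulmxA -/u.
  have x0' : (u^t* *m x) 0 0 = 0 by rewrite uE.
  move: x0'; rewrite /q /nn !mxE => ->; ring.
rewrite pmulr_rge0 //.
have : t * (q + 1) = nn by rewrite divfK ?gt_eqF.
rewrite mulrDr mulr1 => tE; have -> : t * q = nn - t by rewrite -tE addrK.
have -> : nn - t - 2 * nn = - (t + nn) by ring.
by rewrite oppr_ge0 lt_geF // addr_gt0.
Qed.

Lemma psd_congr_eq0 n m (H : 'M[C]_n) (X : 'M[C]_(n, m)) : psd H ->
  X^t* *m H *m X = 0 -> H *m X = 0.
Proof.
move=> psdH XHX; apply/matrixP => i j; rewrite mxE.
suff /colP/(_ i) : H *m (X *m delta_mx j (0 : 'I_1)) = 0.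
  by rewrite mulmxA -colE !mxE.
apply: psd_form_eq0 => //; rewrite trmxC_mul !mulmxA -(mulmxA _ _ H) -(mulmxA _ (_ *m H) X).
by rewrite XHX mulmx0 mul0mx mxE.
Qed.

(* With [B] the projection on the common indices, [C = D2 - B], and [K] solving
   [B H2 B K = B H2], the completion is [P^* H1 P + Q^* H2 Q] for [P = D1 + B K C] and
   [Q = C - B K C]: a sum of congruences, hence positive semidefinite. *)
Lemma psd_completion2 n (D1 D2 H1 H2 : 'M[C]_n) :
  D1^t* = D1 -> D2^t* = D2 -> D1 *m D1 = D1 -> D2 *m D2 = D2 ->
  D1 *m D2 = D2 *m D1 ->
  psd H1 -> psd H2 -> D1 *m H1 *m D1 = H1 -> D2 *m H2 *m D2 = H2 ->
  D1 *m D2 *m H1 *m (D1 *m D2) = D1 *m D2 *m H2 *m (D1 *m D2) ->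
  exists H, [/\ psd H, D1 *m H *m D1 = H1 & D2 *m H *m D2 = H2].
Proof.
move=> D1h D2h D11 D22 D12 psd1 psd2 D1H D2H; set B := D1 *m D2 => agree.
have Bh : B^t* = B by rewrite trmxC_mul D1h D2h -D12.
have BB : B *m B = B by rewrite /B mulmxA -(mulmxA D1) -D12 mulmxA D11 -mulmxA D22.
have BD1 : B *m D1 = B by rewrite /B -mulmxA -D12 mulmxA D11.
have BD2 : B *m D2 = B by rewrite /B -mulmxA D22.
have ED1 : (D2 - B) *m D1 = 0 by rewrite mulmxBl BD1 -D12 subrr.
have D12B : D1 *m D2 = B by [].
clearbody B.
(* The block B H2 B may be singular, so no inverse is used. If Y kills it, then the form of [H2]
   vanishes at B Y, hence H2 B Y = 0; this kernel inclusion is an inclusion of row spaces, which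
   yields [K0]. *)
have [K0 K0P] : exists K0, H2 *m B = K0 *m (B *m H2 *m B).
  apply/submxP; rewrite submxE; apply/eqP; have := mulmx_coker (B *m H2 *m B).
  move: (cokermx _) => Y; rewrite -!mulmxA => BY.
  by apply: psd_congr_eq0; rewrite // trmxC_mul Bh -!mulmxA BY mulmx0.
pose K := B *m K0^t*; pose E := D2 - B; pose X := B + K *m E; pose P := D1 + K *m E.
pose Q := E - K *m E.
have BK : B *m K = K by rewrite /K mulmxA BB.
have KP : B *m H2 *m K = B *m H2.
  have : (H2 *m B)^t* = (K0 *m (B *m H2 *m B))^t* by rewrite K0P.
  by rewrite !trmxC_mul Bh (psd_herm psd2) /K !mulmxA => <-.
have ED2 : E *m D2 = E by rewrite mulmxBl BD2 D22.
have PD1 : P *m D1 = D1 by rewrite mulmxDl D11 -mulmxA ED1 mulmx0 addr0.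
have QD1 : Q *m D1 = 0 by rewrite mulmxBl -mulmxA ED1 mulmx0 subr0.
have PD2 : P *m D2 = X by rewrite mulmxDl -mulmxA ED2 D12B.
have QD2 : Q *m D2 = Q by rewrite mulmxBl -mulmxA ED2.
have BX : B *m X = X by rewrite mulmxDr BB mulmxA BK.
have conj D : D^t* = D -> D *m (P^t* *m H1 *m P + Q^t* *m H2 *m Q) *m D
    = (P *m D)^t* *m H1 *m (P *m D) + (Q *m D)^t* *m H2 *m (Q *m D).
  by move=> Dh; rewrite !trmxC_mul Dh mulmxDr mulmxDl !mulmxA.
exists (P^t* *m H1 *m P + Q^t* *m H2 *m Q); split.
- by apply: psd_add; exact: psd_congr.
- by rewrite conj // PD1 QD1 D1h D1H mulmx0 addr0.
rewrite conj // PD2 QD2.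
(* The range of [X] lies in the common indices, where [H1] and [H2] agree. *)
have XBX M : X^t* *m M *m X = X^t* *m (B *m M *m B) *m X.
  by rewrite -{1 2}BX trmxC_mul Bh !mulmxA.
have XH : X^t* *m H1 *m X = X^t* *m H2 *m X by rewrite XBX agree -XBX.
(* The equation of [K] makes [X] and [Q] orthogonal for [H2], so expanding [H2] along D2 = X + Q
   leaves exactly the two terms of the completion. *)
have XQ : X^t* *m H2 *m Q = 0.
  rewrite -BX trmxC_mul Bh -!mulmxA; suff -> : B *m (H2 *m Q) = 0 by rewrite mulmx0.
  by rewrite mulmxA mulmxBr mulmxA KP subrr.
have QX : Q^t* *m H2 *m X = 0.
  have <- : (X^t* *m H2 *m Q)^t* = Q^t* *m H2 *m X.
    by rewrite !trmxC_mul (psd_herm psd2) trmxCK mulmxA.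
  by rewrite XQ trmx0 map_mx0.
have D2E : D2 = X + Q by rewrite /X /Q addrACA subrr addr0 /E addrC subrK.
have {}D2H : (X + Q)^t* *m H2 *m (X + Q) = H2 by rewrite -D2E D2h.
rewrite XH -[RHS]D2H.
clear - XQ QX; clearbody X Q.
by rewrite trmxCD !(mulmxDl, mulmxDr) XQ QX addr0 add0r.
Qed.

End PSD.

Lemma path_leaves_set (T : finType) (e : rel T) (B : {set T}) x p :
  path e x p -> x \in B -> last x p \notin B ->
  exists j i, [/\ j \in B, i \notin B & e j i].
Proof.
elim: p x => [|y p IH] x /= => [_ ->//|/andP[exy pp] xB].
by have [yB|yB _] := boolP (y \in B); [exact: IH|exists x, y].
Qed.

Definition restr_rel (T : finType) (e : rel T) (B : {set T}) : rel T :=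
  [rel x y | [&& e x y, x \in B & y \in B]].

(** A path from [j] to [k] inside [B], made simple and closed through [i], is a cycle. It has at
    most two vertices, so the path is trivial. *)
Lemma tree_unique_neighbour (T : finType) (e : rel T) (B : {set T}) i j k :
  is_tree e -> connect (restr_rel e B) j k -> i \notin B ->
  j \in B -> e i j -> e i k -> k = j.
Proof.
move=> [esym _ _ acyc] /connectP[p0 pp0 kE] iB jB eij eik.
move: kE; case/shortenP: pp0 => p pp uniqp _ kE.
have pB : {subset p <= B}.
  move=> x; elim: p (j) pp {uniqp kE} => //= y p IH z /andP[/and3P[_ _ yB]] pp.
  by rewrite inE => /predU1P[->//|]; exact: IH pp.
have ijp : i \notin j :: p.
  by apply: contraNN iB; rewrite inE => /predU1P[->//|/pB].
have /acyc : ucycle e (i :: j :: p).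
  rewrite /ucycle cons_uniq ijp uniqp andbT /= eij rcons_path -kE esym eik andbT.
  by rewrite andbT /=; apply: sub_path pp => x y /and3P[].
by case: p kE {pp uniqp pB ijp} => [->|].
Qed.

Section TreeCompletion.
Variables (C : numClosedFieldType) (n : nat).

(** Keeps the blocks of all areas in one matrix space: the sub-matrix on [S], padded with zeros, is
    the compression by this projection. *)
Definition indic_proj (S : {set 'I_n}) : 'M[C]_n := diag_mx (\row_i (i \in S)%:R).
Local Notation proj := indic_proj.

Lemma indic_projM S1 S2 : proj S1 *m proj S2 = proj (S1 :&: S2).
Proof.
rewrite mulmx_diag; congr diag_mx; apply/rowP => i; rewrite !mxE inE.
by case: (i \in S1); rewrite ?mul1r ?mul0r.
Qed.

Lemma indic_proj_herm S : (proj S)^t* = proj S.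
Proof.
rewrite tr_diag_mx map_diag_mx; congr diag_mx; apply/rowP => i; rewrite !mxE.
exact: conjC_nat.
Qed.

Lemma indic_proj_sub (S1 S2 : {set 'I_n}) M : S1 \subset S2 ->
  proj S1 *m (proj S2 *m M *m proj S2) *m proj S1 = proj S1 *m M *m proj S1.
Proof.
move=> S12; rewrite !mulmxA indic_projM -(mulmxA _ (proj S2)) indic_projM.
by rewrite [S2 :&: _]setIC (setIidPl S12).
Qed.

Lemma tree_psd_completion (I : finType) (S : I -> {set 'I_n}) (e : rel I)
    (H : I -> 'M[C]_n) :
  is_tree e -> (forall i j, i != j -> S i :&: S j != set0 -> e i j) ->
  (forall i, psd (H i)) -> (forall i, proj (S i) *m H i *m proj (S i) = H i) ->
  (forall i j, e i j -> proj (S i :&: S j) *m H i *m proj (S i :&: S j)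
                        = proj (S i :&: S j) *m H j *m proj (S i :&: S j)) ->
  exists U, psd U /\ forall i, proj (S i) *m U *m proj (S i) = H i.
Proof.
move=> tree Se psdH HS agree.
have [[i0]|no_i] := pselect (inhabited I); last first.
  exists 0; split=> [|i]; last by case: no_i; exists.
  split=> [|x]; last by rewrite mulmx0 mul0mx mxE.
  by rewrite hermsymmxE trmx0 map_mx0.
(* Connectedness inside [B] belongs to the invariant: acyclicity then leaves the next vertex a
   single neighbour in [B]. *)
pose good (B : {set I}) := [/\ forall x, x \in B -> connect (restr_rel e B) i0 x,
  i0 \in B & exists U, psd U /\ forall i, i \in B -> proj (S i) *m U *m proj (S i) = H i].
suff [B [_ _ [U [psdU UH]]] BT] : exists2 B, good B & #|B| = #|I|.
  exists U; split=> // i; apply: UH.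
  by have /eqP -> : B == setT by rewrite eqEcard subsetT cardsT BT /=.
have I0 : (0 < #|I|)%N by apply/card_gt0P; exists i0.
suff : forall m, (m < #|I|)%N -> exists2 B, good B & #|B| = m.+1.
  by move/(_ #|I|.-1); rewrite prednK // leqnn => /(_ isT).
have [esym eirr econn acyc] := tree.
elim=> [|m IH] mI.
  exists [set i0]; rewrite ?cards1 //; split; rewrite ?inE //.
    by move=> x /set1P ->; exact: connect0.
  by exists (H i0); split=> // i /set1P ->.
have {IH} [B [Bconn i0B [U [psdU UH]]] cardB] := IH (ltnW mI).
have [y yB] : exists y, y \notin B.
  apply/existsP; rewrite -negb_forall; apply: contraTN mI => /forallP BT.
  by rewrite -leqNgt -cardB -cardsT; apply/subset_leq_card/subsetP => x.
have [j [i [jB iB eji]]] : exists j i, [/\ j \in B, i \notin B & e j i].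
  have /connectP[p pp yE] := econn i0 y.
  by apply: (path_leaves_set pp i0B); rewrite -yE.
have eB_sym : connect_sym (restr_rel e B).
  by apply: sym_connect_sym => x z; rewrite /restr_rel /= esym [(x \in B) && _]andbC.
have nbr k : k \in B -> S i :&: S k != set0 -> k = j.
  move=> kB ik; apply: (tree_unique_neighbour (i := i) (B := B) tree) => //.
  - by apply: connect_trans _ (Bconn k kB); rewrite eB_sym; exact: Bconn.
  - by rewrite esym.
  - by apply: Se ik; apply: contraNneq iB => ->.
pose SB := \bigcup_(k in B) S k.
have SiB : S i :&: SB = S i :&: S j.
  apply/setP => t; rewrite !inE; case: (boolP (t \in S i)) => //= tSi.
  apply/bigcupP/idP => [[k kB tk]|tj]; last by exists j.
  rewrite -(nbr k kB) //; apply/set0Pn; exists t; by rewrite inE tSi.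
have SkB k : k \in B -> S k \subset SB by move=> kB; exact: bigcup_sup.
(* [U] is prescribed on the blocks only. Cutting it down to the indices used so far gives it the
   shape that [psd_completion2] requires. *)
pose H1 := proj SB *m U *m proj SB.
have H1k k : k \in B -> proj (S k) *m H1 *m proj (S k) = H k.
  by move=> kB; rewrite indic_proj_sub ?SkB // UH.
have [||||||V [psdV V1 V2]] := psd_completion2 (indic_proj_herm SB) (indic_proj_herm (S i))
  _ _ _ (_ : psd H1) (psdH i) _ (HS i).
- by rewrite indic_projM setIid.
- by rewrite indic_projM setIid.
- by rewrite !indic_projM setIC.
- by rewrite /H1 -{1}[proj SB]indic_proj_herm; exact: psd_congr.
- by rewrite /H1 !mulmxA indic_projM -(mulmxA _ (proj SB)) indic_projM setIid.
- rewrite indic_projM setIC SiB agree 1?esym //.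
  by rewrite -(H1k j jB) indic_proj_sub // subsetIr.
exists (i |: B); last by rewrite cardsU1 iB cardB.
have sub : subrel (restr_rel e B) (restr_rel e (i |: B)).
  by move=> x z /and3P[exz xB zB]; apply/and3P; rewrite !inE xB zB !orbT.
split; rewrite ?inE ?i0B ?orbT //.
  have cB x : x \in B -> connect (restr_rel e (i |: B)) i0 x.
    move=> xB; apply: connect_sub (Bconn x xB) => u v uv; exact/connect1/sub.
  move=> x /setU1P[->|]; last exact: cB.
  apply: connect_trans (cB j jB) _; apply: connect1.
  by apply/and3P; rewrite !inE jB eqxx orbT.
exists V; split=> // k /setU1P[->//|kB].
by rewrite -(H1k k kB) -V1 indic_proj_sub // SkB.
Qed.
End TreeCompletion.

(** * Entries and sub-matrices of matrices indexed by sets *)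

Section IndexedMatrixTheory.
Variables (T : finType).

Section Nmodule.
Variable F : nmodType.
Implicit Types A B : {set T}.

Lemma entry_enum_val A (M : 'M[F]_#|A|) i j : entry M (enum_val i) (enum_val j) = M i j.
Proof.
rewrite /entry (big_pred1 i) => [|k]; last exact: (inj_eq enum_val_inj).
by rewrite (big_pred1 j) => // k; exact: (inj_eq enum_val_inj).
Qed.

Lemma entry_out A (M : 'M[F]_#|A|) x y : ~~ ((x \in A) && (y \in A)) -> entry M x y = 0.
Proof.
rewrite negb_and => /orP[] out; rewrite /entry; first rewrite big_pred0 // => i.
  by apply: contraNF out => /eqP <-; exact: enum_valP.
apply: big1 => i _; rewrite big_pred0 // => j.
by apply: contraNF out => /eqP <-; exact: enum_valP.
Qed.

Lemma entry_rank A (M : 'M[F]_#|A|) x y (xA : x \in A) (yA : y \in A) :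
  entry M x y = M (enum_rank_in xA x) (enum_rank_in yA y).
Proof. by rewrite -entry_enum_val !enum_rankK_in. Qed.

Lemma entry_matrix A (f : T -> T -> F) x y :
  entry (\matrix_(i < #|A|, j < #|A|) f (enum_val i) (enum_val j)) x y =
  if (x \in A) && (y \in A) then f x y else 0.
Proof.
case: ifPn => [/andP[xA yA]|]; last exact: entry_out.
by rewrite (entry_rank _ xA yA) mxE !enum_rankK_in.
Qed.

Lemma entry_blk A B (M : 'M[F]_#|A|) x y :
  entry (blk B M) x y = if (x \in B) && (y \in B) then entry M x y else 0.
Proof. exact: entry_matrix. Qed.

Lemma entry_inj A (M N : 'M[F]_#|A|) :
  (forall x y, x \in A -> y \in A -> entry M x y = entry N x y) -> M = N.
Proof.
move=> MN; apply/matrixP => i j; rewrite -!entry_enum_val.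
by apply: MN; exact: enum_valP.
Qed.

Lemma entryD A (M N : 'M[F]_#|A|) x y : entry (M + N) x y = entry M x y + entry N x y.
Proof.
have [/andP[xA yA]|out] := boolP ((x \in A) && (y \in A)).
  by rewrite !(entry_rank _ xA yA) mxE.
by rewrite !entry_out ?addr0.
Qed.

Lemma entry0 A x y : entry (0 : 'M[F]_#|A|) x y = 0.
Proof.
have [/andP[xA yA]|out] := boolP ((x \in A) && (y \in A)).
  by rewrite (entry_rank _ xA yA) mxE.
by rewrite entry_out.
Qed.

Lemma entry_tr A (M : 'M[F]_#|A|) x y : entry M^T x y = entry M y x.
Proof.
have [/andP[xA yA]|out] := boolP ((x \in A) && (y \in A)).
  by rewrite (entry_rank _ xA yA) (entry_rank _ yA xA) mxE.
by rewrite !entry_out // andbC.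
Qed.

Lemma sum_enum_val A (f : T -> F) : \sum_(i < #|A|) f (enum_val i) = \sum_(x in A) f x.
Proof. by rewrite [RHS]big_enum_val. Qed.

End Nmodule.

Lemma entry_map (F F' : nmodType) (g : F -> F') (A : {set T}) (M : 'M[F]_#|A|) x y :
  g 0 = 0 -> entry (map_mx g M) x y = g (entry M x y).
Proof.
move=> g0; have [/andP[xA yA]|out] := boolP ((x \in A) && (y \in A)).
  by rewrite !(entry_rank _ xA yA) mxE.
by rewrite !entry_out.
Qed.

Lemma entryN (F : zmodType) (A : {set T}) (M : 'M[F]_#|A|) x y :
  entry (- M) x y = - entry M x y.
Proof.
have [/andP[xA yA]|out] := boolP ((x \in A) && (y \in A)).
  by rewrite !(entry_rank _ xA yA) mxE.
by rewrite !entry_out ?oppr0.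
Qed.

Lemma entryZ (F : nzRingType) (A : {set T}) (M : 'M[F]_#|A|) a x y :
  entry (a *: M) x y = a * entry M x y.
Proof.
have [/andP[xA yA]|out] := boolP ((x \in A) && (y \in A)).
  by rewrite !(entry_rank _ xA yA) mxE.
by rewrite !entry_out ?mulr0.
Qed.

Lemma sum_mx_entry (F F' : nmodType) (g : F -> F -> F') (A : {set T}) (M N : 'M[F]_#|A|) :
  \sum_i \sum_j g (M i j) (N i j) =
  \sum_(x in A) \sum_(y in A) g (entry M x y) (entry N x y).
Proof.
rewrite -sum_enum_val; apply: eq_bigr => i _; rewrite -sum_enum_val.
by apply: eq_bigr => j _; rewrite !entry_enum_val.
Qed.

Lemma mxtrace_mul_entry (F : nzRingType) (A : {set T}) (M N : 'M[F]_#|A|) :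
  \tr (M *m N) = \sum_x \sum_y entry M x y * entry N y x.
Proof.
have -> : \tr (M *m N) = \sum_i \sum_j M i j * N^T i j.
  by apply: eq_bigr => i _; rewrite mxE; apply: eq_bigr => j _; rewrite mxE.
rewrite (sum_mx_entry (fun a b => a * b)) big_mkcond; apply: eq_bigr => x _.
case: ifPn => xA; last first.
  by rewrite big1 // => y _; rewrite entry_out ?mul0r // (negbTE xA).
rewrite big_mkcond; apply: eq_bigr => y _; rewrite entry_tr.
by case: ifPn => // yA; rewrite entry_out ?mul0r // (negbTE yA) andbF.
Qed.

(** Entries outside [A] are zero, so only the part of [D] inside [A] has to survive in [B]. *)
Lemma blk_blk (F : nmodType) (A B D : {set T}) (M : 'M[F]_#|A|) :
  A :&: D \subset B -> blk D (blk B M) = blk D M.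
Proof.
move=> /subsetP ADB; apply: entry_inj => x y xD yD; rewrite !entry_blk xD yD /=.
case: ifPn => // out; rewrite entry_out //; apply: contraNN out => /andP[xA yA].
by rewrite !ADB // inE ?xA ?yA.
Qed.

Lemma blk_psd (C : numClosedFieldType) (A B : {set T}) (M : 'M[C]_#|A|) :
  psd M -> psd (blk B M).
Proof.
(* A selection matrix. An index of [B] outside [A] has a zero column, so the congruence also
   performs the zero-padding. *)
pose E : 'M[C]_(#|A|, #|B|) := \matrix_(i, j) (enum_val i == enum_val j)%:R.
suff -> : blk B M = E^t* *m M *m E by exact: psd_congr.
apply/matrixP => i j; rewrite !mxE /entry [RHS](eq_bigr (fun k =>
  \sum_l (enum_val l == enum_val i)%:R * (enum_val k == enum_val j)%:R * M l k)).
  rewrite exchange_big /= big_mkcond /=; apply: eq_bigr => l _.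
  case: eqP => _; last by rewrite big1 // => k _; rewrite mulr0 mul0r.
  rewrite big_mkcond; apply: eq_bigr => k _.
  by case: eqP => _; rewrite mulr1 ?mul1r ?mul0r.
move=> k _; rewrite !mxE mulr_suml; apply: eq_bigr => l _; rewrite !mxE.
by rewrite mulrAC; congr (_ * _ * _); exact: conjC_nat.
Qed.

End IndexedMatrixTheory.

(** Blocks of different sizes are padded to the index set [A], where taking sub-matrices becomes
    compression by [indic_proj]. *)
Lemma overlap_psd_completion (C : numClosedFieldType) (T I : finType) (A : {set T})
    (S : I -> {set T}) (e : rel I) (V : forall i, 'M[C]_#|S i|) :
  is_tree e -> (forall i, S i \subset A) ->
  (forall i j, i != j -> S i :&: S j != set0 -> e i j) ->
  (forall i, psd (V i)) ->
  (forall i j x y, e i j -> x \in S i :&: S j -> y \in S i :&: S j ->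
     entry (V i) x y = entry (V j) x y) ->
  exists U : 'M[C]_#|A|, psd U /\ forall i, blk (S i) U = V i.
Proof.
move=> tree /(_ _)/subsetP SA Se psdV agree.
pose P i := [set a : 'I_#|A| | enum_val a \in S i].
have projE (Q : {set 'I_#|A|}) (M : 'M[C]_#|A|) a b :
    (indic_proj C Q *m M *m indic_proj C Q) a b =
    if (a \in Q) && (b \in Q) then M a b else 0.
  rewrite mul_mx_diag mxE mul_diag_mx !mxE.
  by do 2!case: (_ \in _); rewrite ?mul1r ?mulr1 ?mul0r ?mulr0.
have [||||U [psdU UV]] := @tree_psd_completion C _ I P e (fun i => blk A (V i)) tree.
- move=> i j ij /set0Pn[a]; rewrite !inE => /andP[ai aj]; apply: Se ij _.
  by apply/set0Pn; exists (enum_val a); rewrite inE ai.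
- by move=> i; exact: blk_psd.
- move=> i; apply/matrixP => a b; rewrite projE mxE !inE.
  by case: ifPn => // out; rewrite entry_out.
- move=> i j eij; apply/matrixP => a b; rewrite !projE !mxE !inE.
  by case: ifPn => // /andP[aij bij]; rewrite (agree i j) // inE.
exists U; split=> // i; apply: entry_inj => x y xi yi; rewrite entry_blk xi yi /=.
have xA := SA _ _ xi; have yA := SA _ _ yi.
have := projE (P i) U (enum_rank_in xA x) (enum_rank_in yA y).
rewrite UV mxE !inE !enum_rankK_in // xi yi -entry_rank /= => <- //.
Qed.

(** * Equivalence of (P3) and (P6) *)

Section Locality.
Variables (R : realType) (G : network R).
Local Open Scope complex_scope.
Implicit Types S : {set bus_phase G}.

Definition supported S (M : 'M[R[i]]_#|busphases G|) :=
  forall a b, ~~ ((enum_val a \in S) && (enum_val b \in S)) -> M a b = 0.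

Definition col_supported S m (M : 'M[R[i]]_(m, #|busphases G|)) :=
  forall a b, enum_val b \notin S -> M a b = 0.

Lemma supportedD S M N : supported S M -> supported S N -> supported S (M + N).
Proof. by move=> sM sN a b ab; rewrite mxE sM // sN // addr0. Qed.

Lemma supportedZ S c M : supported S M -> supported S (c *: M).
Proof. by move=> sM a b ab; rewrite mxE sM // mulr0. Qed.

Lemma supportedN S M : supported S M -> supported S (- M).
Proof. by move=> sM a b ab; rewrite mxE sM // oppr0. Qed.

Lemma supported_trmxC S M : supported S M -> supported S (M^t*).
Proof. by move=> sM a b ab; rewrite !mxE sM ?rmorph0 // andbC. Qed.

Lemma supported_mul S m (M N : 'M[R[i]]_(m, #|busphases G|)) :
  col_supported S M -> col_supported S N -> supported S (M^t* *m N).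
Proof.
move=> sM sN a b; rewrite negb_and mxE => /orP[out|out]; apply: big1 => k _.
  by rewrite !mxE sM // rmorph0 mul0r.
by rewrite sN // mulr0.
Qed.

Lemma trR_blk S (Phi V : 'M[R[i]]_#|busphases G|) : supported S Phi ->
  trR (blk S Phi) (blk S V) = trR Phi V.
Proof.
move=> sPhi; rewrite /trR !mxtrace_mul_entry; congr complex.Re.
apply: eq_bigr => x _; apply: eq_bigr => y _; rewrite !entry_blk andbC.
case: ifPn => // out; have [/andP[xA yA]|] := boolP ((x \in busphases G) && (y \in busphases G)).
  by rewrite (entry_rank _ xA yA) sPhi ?mul0r // !enum_rankK_in // andbC.
by move=> ?; rewrite entry_out ?mul0r.
Qed.

Variables (L : nat) (A : 'I_L -> {set node G}).

Lemma ext_sub l : ext A l \subset busphases G.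
Proof. by apply/subsetP => x; rewrite inE => /andP[]. Qed.

Lemma area_sub_ext l n : n \in A l -> n \in Abar A l.
Proof. by rewrite inE => ->. Qed.

Lemma adj_sub_ext l m n : m \in A l -> adj m n -> n \in Abar A l.
Proof. by move=> mA mn; rewrite !inE; apply/orP; right; apply/existsP; exists m; rewrite mA. Qed.

Lemma ext_enum_val l (a : 'I_#|busphases G|) :
  (enum_val a \in ext A l) = ((enum_val a).1 \in Abar A l).
Proof. by rewrite inE enum_valP. Qed.

(** The admittance row of node [n] involves only [n] and the nodes joined to it, all of which lie in
    the extended area. *)
Lemma Ynp_supported l n p : n \in A l -> supported (ext A l) (Ynp n p).
Proof.
move=> nA a b; rewrite !ext_enum_val negb_and /Ynp -mulmxA mxE big_ord1 !mxE.
case: eqP => [->|_ _]; last by rewrite mul0r.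
rewrite area_sub_ext //= => bout; rewrite big1 ?mulr0 // => k _; rewrite !mxE.
case: eqP => [->|_]; last by rewrite mul0r.
rewrite /= ifN; last by apply: contraNneq bout => <-; exact: area_sub_ext.
by rewrite ifN ?mulr0 //; apply: contraNN bout; exact: adj_sub_ext.
Qed.

Lemma PhiP_supported l n p : n \in A l -> supported (ext A l) (PhiP n p).
Proof.
move=> nA; apply/supportedZ/supportedD; last apply: supported_trmxC; exact: Ynp_supported.
Qed.

Lemma PhiQ_supported l n p : n \in A l -> supported (ext A l) (PhiQ n p).
Proof.
move=> nA; apply/supportedZ/supportedD; last apply/supportedN/supported_trmxC;
  exact: Ynp_supported.
Qed.

Lemma PhiV_supported l n p : n \in A l -> supported (ext A l) (PhiV n p).
Proof.
move=> nA a b; rewrite !ext_enum_val negb_and mxE big_ord1 !mxE.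
case: eqP => [->|_ _]; last by rewrite mul0r.
rewrite area_sub_ext //=; case: eqP => [->|_ _]; last by rewrite mulr0.
by rewrite area_sub_ext.
Qed.

Lemma Bsel_supported l e m : m \in Abar A l -> col_supported (ext A l) (Bsel e m).
Proof.
move=> mA a b; rewrite ext_enum_val mxE; case: eqP => [->|//].
by rewrite mA.
Qed.

Lemma Aflow_supported l m n : m \in Abar A l -> n \in Abar A l ->
  col_supported (ext A l) (Aflow m n).
Proof.
move=> mA nA a b bout; rewrite mxE big1 // => k _; rewrite !mxE.
have /(_ k b bout) := Bsel_supported (e := line m n) mA.
have /(_ k b bout) := Bsel_supported (e := line m n) nA.
by rewrite !mxE => -> ->; rewrite subr0 mulr0.
Qed.

Lemma PhiF_supported l m n : m \in Abar A l -> n \in Abar A l ->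
  supported (ext A l) (PhiF m n).
Proof.
move=> mA nA; apply/supportedZ/supportedD; apply: supported_mul;
  by [exact: Aflow_supported|exact: Bsel_supported].
Qed.

Lemma node_constraints_ext l (V : 'M[R[i]]_#|busphases G|) :
  node_constraints (A l) (fun Phi => trR (blk (ext A l) Phi) (blk (ext A l) V)) <->
  node_constraints (A l) (fun Phi => trR Phi V).
Proof.
have eP n p : n \in A l -> trR (blk (ext A l) (PhiP n p)) (blk (ext A l) V) = trR (PhiP n p) V.
  by move=> nA; rewrite trR_blk //; exact: PhiP_supported.
have eQ n p : n \in A l -> trR (blk (ext A l) (PhiQ n p)) (blk (ext A l) V) = trR (PhiQ n p) V.
  by move=> nA; rewrite trR_blk //; exact: PhiQ_supported.
have eV n p : n \in A l -> trR (blk (ext A l) (PhiV n p)) (blk (ext A l) V) = trR (PhiV n p) V.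
  by move=> nA; rewrite trR_blk //; exact: PhiV_supported.
split=> -[a b c d e]; split=> n p nA.
- by move=> ? ?; rewrite -eP //; exact: a.
- by move=> ? ?; rewrite -eQ // -eV //; exact: b.
- by move=> ? ?; rewrite -eP //; exact: c.
- by move=> ? ?; rewrite -eQ //; exact: d.
- by move=> ?; rewrite -eV //; exact: e.
- by move=> ? ?; rewrite eP //; exact: a.
- by move=> ? ?; rewrite eQ // eV //; exact: b.
- by move=> ? ?; rewrite eP //; exact: c.
- by move=> ? ?; rewrite eQ //; exact: d.
- by move=> ?; rewrite eV //; exact: e.
Qed.

Lemma pcc_constraint_ext l (V : 'M[R[i]]_#|busphases G|) : ord0 \in A l ->
  pcc_constraint (blk (ext A l) V) <-> pcc_constraint V.
Proof.
move=> zA; rewrite /pcc_constraint.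
suff -> : (\matrix_(p < 3, q < 3) entry (blk (ext A l) V) (ord0, p) (ord0, q)) =
          \matrix_(p < 3, q < 3) entry V (ord0, p) (ord0, q) by [].
apply/matrixP => p q; rewrite !mxE entry_blk.
have inext r : ((ord0, r) : bus_phase G) \in ext A l.
  by rewrite inE /= area_sub_ext // andbT inE /= phases_pcc inE.
by rewrite !inext.
Qed.

Hypothesis partA : area_partition A.

Lemma area_ofP n : exists l, n \in A l.
Proof.
have [_ _ cov] := partA; have : n \in \bigcup_l A l by rewrite cov inE.
by move/bigcupP => [l _ nA]; exists l.
Qed.

Lemma sum_area n : \sum_l (n \in A l)%:R = 1 :> R.
Proof.
have [l nA] := area_ofP n; have [_ disj _] := partA.
rewrite (bigD1 l) //= nA big1 ?addr0 // => j jl.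
by have := disjointFl (disj _ _ jl) nA => ->.
Qed.

Definition restrict (V : 'M[R[i]]_#|busphases G|) : area_mats A := fun l => blk (ext A l) V.

(** The weights of [C1loc] give a line one half per end in the area. Each end lies in exactly one
    area, so the weights of a line add up to one. *)
Lemma C1_split V : C1 V = \sum_l C1loc (restrict V l).
Proof.
pose t e := trR (PhiF e.1 e.2) V + trR (PhiF e.2 e.1) V.
have tE l e : e.1 \in Abar A l -> e.2 \in Abar A l ->
    trR (blk (ext A l) (PhiF e.1 e.2 + PhiF e.2 e.1)) (restrict V l) = t e.
  move=> e1 e2; rewrite trR_blk; last by apply: supportedD; exact: PhiF_supported.
  by rewrite /trR mulmxDl linearD /= raddfD.
have locE l : C1loc (restrict V l) =
    \sum_(e in lines G) 2^-1 * ((e.1 \in A l)%:R + (e.2 \in A l)%:R) * t e.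
  rewrite /C1loc /= big_mkcondr [X in _ + X]big_mkcondr -big_split /=.
  apply: eq_bigr => e eG.
  have e12 : adj e.1 e.2 by rewrite /adj -surjective_pairing eG.
  have e21 : adj e.2 e.1 by rewrite /adj -surjective_pairing eG orbT.
  have [e1|e1] := boolP (e.1 \in A l); have [e2|e2] := boolP (e.2 \in A l) => /=.
  - by rewrite tE ?area_sub_ext //; field.
  - by rewrite tE ?(adj_sub_ext e1 e12) ?area_sub_ext //; field.
  - by rewrite tE ?(adj_sub_ext e2 e21) ?area_sub_ext //; field.
  - by rewrite !addr0 mulr0 mul0r.
under eq_bigr do rewrite locE; rewrite exchange_big; apply: eq_bigr => e _ /=.
rewrite -mulr_suml -mulr_sumr big_split /= !sum_area /t; by field.
Qed.

Variables (k : objective) (f : forall l : 'I_L, 'M[R[i]]_#|ext A l| -> R).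
Hypothesis splitf : k = Supply -> C2_split f.

Lemma Ck_split : exists c : R, forall V, V \is hermsymmx ->
  Ck k V = \sum_l Cloc k f (restrict V l) + c.
Proof.
case: k splitf => [_|/(_ erefl)[_ [c cP]]]; last by exists c.
by exists 0 => V _; rewrite addr0 /= C1_split.
Qed.

Definition agreeing (V : area_mats A) :=
  forall l j, j \in Nbar A l -> own V l j = other V l j.

Lemma restrict_agreeing V : agreeing (restrict V).
Proof.
move=> l j jl; rewrite /own /other /restrict !blk_blk //.
  by apply: subset_trans (subsetIr _ _) _; apply/subsetP => x; rewrite !inE => /and3P[-> *].
by apply: subset_trans (subsetIr _ _) _; apply/subsetP => x; rewrite !inE => /and3P[-> *].
Qed.

Lemma restrict_domain V : P3_feasible V -> V_domain (restrict V).
Proof.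
move=> [[a b c d e] pcc psdV] l; split; first exact: blk_psd.
split; last by move=> zA; apply/pcc_constraint_ext.
apply/node_constraints_ext; split=> n p _; first exact: a (in_setT n).
- exact: b (in_setT n).
- exact: c (in_setT n).
- exact: d (in_setT n).
- exact: e (in_setT n).
Qed.

(** Each constraint of (P3) sits at one node and is local to the area of that node, so the glued
    matrix inherits it. *)
Lemma agreeing_completion V : As1 A -> V_domain V -> agreeing V ->
  exists2 U, P3_feasible U & forall l, blk (ext A l) U = V l.
Proof.
move=> as1 VD Vag.
have [||||U [psdU UV]] := overlap_psd_completion (A := busphases G) (V := V) as1.
- exact: ext_sub.
- move=> l j lj /set0Pn[x]; rewrite !inE => /andP[/andP[_ xl] /andP[_ xj]].
  rewrite eq_sym lj; apply/set0Pn; exists x.1; by rewrite !inE xl.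
- by move=> l; exact: (VD l).1.
- move=> l j x y jl xlj ylj; have := congr1 (fun M => entry M x y) (Vag l j jl).
  have sh z : z \in ext A l :&: ext A j -> z \in Psh A l j.
    by rewrite !inE => /andP[/andP[-> ->] /andP[_ ->]].
  by rewrite /own /other !entry_blk !sh.
exists U => //.
have nc l : node_constraints (A l) (fun Phi => trR Phi U).
  by apply/node_constraints_ext; rewrite UV; exact: (VD l).2.1.
split=> //.
  split=> n p _; have [l nA] := area_ofP n; have [a b c d e] := nc l.
  - exact: a. - exact: b. - exact: c. - exact: d. - exact: e.
have [l zA] := area_ofP ord0.
by apply/(pcc_constraint_ext _ zA); rewrite UV; exact: (VD l).2.2.
Qed.

(** The gluing of [V] is optimal for (P3): a feasible competitor restricts to an agreeing family,
    and the additive constant of the cost splitting cancels. *)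
Lemma agreeing_minimizer_unique (Vopt : 'M[R[i]]_#|busphases G|) (V : area_mats A) : As1 A ->
  (forall U, P3_optimal k U -> forall l, blk (ext A l) U = blk (ext A l) Vopt) ->
  V_domain V -> agreeing V ->
  (forall W, V_domain W -> agreeing W ->
     \sum_l Cloc k f (V l) <= \sum_l Cloc k f (W l)) ->
  forall l, V l = blk (ext A l) Vopt.
Proof.
move=> as1 uniq VD Vag Vmin l.
have [U Ufeas UV] := agreeing_completion as1 VD Vag.
have [c cP] := Ck_split; rewrite -UV; apply: uniq; split=> // W Wfeas.
have herm X : P3_feasible X -> X \is hermsymmx by case=> _ _ [].
rewrite !cP ?herm // lerD2r; under eq_bigr do rewrite /restrict UV.
by apply: Vmin; [exact: restrict_domain|exact: restrict_agreeing].
Qed.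

End Locality.

(** * Equivalence of the updates *)

(** Competitors that differ from [v] at a single index, built by [dfwith], separate the sum. *)
Lemma separable_min (R : realDomainType) (I : finType) (U : I -> Type)
    (D : forall i, U i -> Prop) (h : forall i, U i -> R) (v : forall i, U i) :
  ((forall i, D i (v i)) /\
   forall u, (forall i, D i (u i)) -> \sum_i h i (v i) <= \sum_i h i (u i)) <->
  forall i, D i (v i) /\ forall u, D i u -> h i (v i) <= h i u.
Proof.
split=> [[Dv vmin] i|vmin].
  split=> // u Du; have := vmin (dfwith v u).
  rewrite (bigD1 i) //= [leRHS](bigD1 i) //= dfwith_in.
  have -> : \sum_(j | j != i) h j (dfwith v u j) = \sum_(j | j != i) h j (v j).
    by apply: eq_bigr => j ji; rewrite dfwith_out // eq_sym.
  rewrite lerD2r; apply=> j; have [->|ji] := eqVneq j i; first by rewrite dfwith_in.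
  by rewrite dfwith_out // eq_sym.
split=> [i|u Du]; first exact: (vmin i).1.
by apply: ler_sum => i _; exact: (vmin i).2.
Qed.

Lemma frobenius_sqr (R : rcfType) m n (M : 'M[R]_(m, n)) :
  frobenius M ^+ 2 = \sum_i \sum_j M i j ^+ 2.
Proof.
by rewrite sqr_sqrtr // sumr_ge0 // => i _; rewrite sumr_ge0 // => j _; exact: sqr_ge0.
Qed.

Lemma frobenius_mxvec (R : rcfType) m n (M : 'M[R]_(m, n)) :
  (mxvec M *m (mxvec M)^T) 0 0 = frobenius M ^+ 2.
Proof.
rewrite frobenius_sqr mxE (reindex _ (curry_mxvec_bij _ _)) /= pair_bigA /=.
by apply: eq_bigr => -[i j] _ /=; rewrite mxE mxvecE expr2.
Qed.

(* Schur complement of the block [- I]. *)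
Lemma real_nsd_lmi (R : realType) n (a : R) (r : 'cV[R]_n) :
  real_nsd (lmi a r) <-> (r^T *m r) 0 0 <= a.
Proof.
have form (x : 'cV[R]_1) (y : 'cV[R]_n) :
    ((col_mx x y)^T *m lmi a r *m col_mx x y) 0 0 =
    (x 0 0) ^+ 2 * ((r^T *m r) 0 0 - a) - ((x 0 0 *: r - y)^T *m (x 0 0 *: r - y)) 0 0.
  rewrite tr_col_mx /lmi mul_row_block mul_row_col !mulmxDl.
  have mulx (M : 'M[R]_1) : (M *m x) 0 0 = M 0 0 * x 0 0 by rewrite mxE big_ord1.
  have xmul (M : 'M[R]_1) : (x^T *m M) 0 0 = x 0 0 * M 0 0 by rewrite mxE big_ord1 mxE.
  have yr : (y^T *m r) 0 0 = (r^T *m y) 0 0.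
    have -> : r^T *m y = (y^T *m r)^T by rewrite trmx_mul trmxK.
    by rewrite [RHS]mxE.
  rewrite mulmxN mulmx1 mulNmx -[x^T *m r^T *m y]mulmxA.
  have -> : (x 0 0 *: r - y)^T = x 0 0 *: r^T - y^T by rewrite linearB /= linearZ.
  rewrite !(mulmxBl, mulmxBr) -!scalemxAl -!scalemxAr.
  have mxD (M N : 'M[R]_1) : (M + N) 0 0 = M 0 0 + N 0 0 by rewrite mxE.
  have mxN (M : 'M[R]_1) : (- M) 0 0 = - M 0 0 by rewrite mxE.
  have mxZ c (M : 'M[R]_1) : (c *: M) 0 0 = c * M 0 0 by rewrite mxE.
  rewrite !(mxD, mxN, mxZ, mulx, xmul) yr mxE eqxx mulr1n; ring.
split=> [[_ nsd]|ra].
  have := nsd (col_mx 1%:M r); rewrite form; have -> : (1%:M : 'M[R]_1) 0 0 = 1 by rewrite mxE.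
  by rewrite expr1n mul1r scale1r subrr mulmx0 [X in _ - X]mxE subr0 subr_le0.
split; first by rewrite /lmi tr_block_mx trmxK !linearN /= tr_scalar_mx trmx1.
move=> x; rewrite -[x]vsubmxK form.
have : 0 <= ((usubmx x 0 0 *: r - dsubmx x)^T *m (usubmx x 0 0 *: r - dsubmx x)) 0 0.
  by rewrite mxE sumr_ge0 // => i _; rewrite mxE -expr2 sqr_ge0.
have := sqr_ge0 (usubmx x 0 0); rewrite -subr_le0 in ra.
by have := mulr_ge0_le0 (sqr_ge0 (usubmx x 0 0)) ra; lra.
Qed.

Section ComplexParts.
Variables (R : realType) (m n : nat).
Local Open Scope complex_scope.
Implicit Types M N : 'M[R[i]]_(m, n).

Lemma half_complex : (2^-1 : R[i]) = (2^-1)%:C.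
Proof. by rewrite fmorphV /= rmorph_nat. Qed.

Lemma Re_half (z : R[i]) : complex.Re (2^-1 * z) = 2^-1 * complex.Re z.
Proof. by rewrite half_complex; case: z => a b /=; rewrite mul0r subr0. Qed.

Lemma Im_half (z : R[i]) : complex.Im (2^-1 * z) = 2^-1 * complex.Im z.
Proof. by rewrite half_complex; case: z => a b /=; rewrite mul0r addr0. Qed.

Lemma reMD M N : reM (M + N) = reM M + reM N.
Proof. by apply/matrixP => a b; rewrite !mxE raddfD. Qed.

Lemma imMD M N : imM (M + N) = imM M + imM N.
Proof. by apply/matrixP => a b; rewrite !mxE raddfD. Qed.

Lemma reMB_half M N : reM (M - 2^-1 *: N) = reM M - 2^-1 *: reM N.
Proof. by apply/matrixP => a b; rewrite !mxE raddfB /= Re_half. Qed.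

Lemma imMB_half M N : imM (M - 2^-1 *: N) = imM M - 2^-1 *: imM N.
Proof. by apply/matrixP => a b; rewrite !mxE raddfB /= Im_half. Qed.

End ComplexParts.

Section Updates.
Variables (R : realType) (G : network R) (L : nat) (A : 'I_L -> {set node G}).
Variables (k : objective) (f : forall l : 'I_L, 'M[R[i]]_#|ext A l| -> R) (kappa : R).
Hypothesis kappa_gt0 : 0 < kappa.
Implicit Types (V : area_mats A) (W X Gam Lam : pair_mats A).

(** With [im_mean], the values that [S2] gives to the auxiliary matrices when the multipliers of the
    two copies are opposite. *)
Definition re_mean V : pair_mats A := fun l j => 2^-1 *: reM (own V l j + other V l j).
Definition im_mean V : pair_mats A := fun l j => 2^-1 *: imM (own V l j + other V l j).

Lemma Nbar_sym l j : (j \in Nbar A l) = (l \in Nbar A j).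
Proof. by rewrite !inE eq_sym setIC. Qed.

Lemma Psh_sym l j : Psh A l j = Psh A j l.
Proof. by rewrite /Psh setIC. Qed.

Lemma swap_re_mean V l j : swap (re_mean V) l j = re_mean V l j.
Proof.
apply: entry_inj => s t sP tP; rewrite entry_blk sP tP /= /re_mean.
rewrite !entryZ !entry_map // !entryD /own /other !entry_blk ![Psh A j l]Psh_sym sP tP /=.
by rewrite addrC.
Qed.

Lemma swap_im_mean V l j : swap (im_mean V) l j = im_mean V l j.
Proof.
apply: entry_inj => s t sP tP; rewrite entry_blk sP tP /= /im_mean.
rewrite !entryZ !entry_map // !entryD /own /other !entry_blk ![Psh A j l]Psh_sym sP tP /=.
by rewrite addrC.
Qed.

Definition agree_on W W' := forall l j, j \in Nbar A l -> W l j = W' l j.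

Lemma swap_agree W W' : agree_on W W' -> agree_on (swap W) (swap W').
Proof. by move=> WW l j jl; rewrite /swap WW // -Nbar_sym. Qed.

Definition area_lagr W X Gam Lam l (U : 'M[R[i]]_#|ext A l|) : R :=
  Cloc k f U + \sum_(j in Nbar A l)
    (\tr ((Gam l j)^T *m (reM (blk (Psh A l j) U) - swap W l j))
     + \tr ((Lam l j)^T *m (imM (blk (Psh A l j) U) - swap X l j))
     + kappa / 2 * frobenius (reM (blk (Psh A l j) U) - swap W l j) ^+ 2
     + kappa / 2 * frobenius (imM (blk (Psh A l j) U) - swap X l j) ^+ 2).

Lemma S1_areas W X Gam Lam V' : S1 k f kappa W X Gam Lam V' <->
  forall l, (psd (V' l) /\ inB (V' l)) /\ forall U, psd U /\ inB U ->
    area_lagr W X Gam Lam (V' l) <= area_lagr W X Gam Lam (U : 'M[R[i]]_#|ext A l|).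
Proof.
exact: (separable_min (fun l (U : 'M[R[i]]_#|ext A l|) => psd U /\ inB U)
  (fun l U => area_lagr W X Gam Lam U) V').
Qed.

Definition dev_re V l (U : 'M[R[i]]_#|ext A l|) j := frobenius (reM (deviation V U j)) ^+ 2.
Definition dev_im V l (U : 'M[R[i]]_#|ext A l|) j := frobenius (imM (deviation V U j)) ^+ 2.

Lemma P7_feasibleE V l (U : 'M[R[i]]_#|ext A l|) a b : P7_feasible V U a b <->
  (psd U /\ inB U) /\ forall j, j \in Nbar A l -> dev_re V U j <= a j /\ dev_im V U j <= b j.
Proof.
split=> [[pU BU h]|[[pU BU] h]]; split=> // j jl; have := h j jl.
  by move=> [_ _ /real_nsd_lmi + /real_nsd_lmi]; rewrite !trmxK !frobenius_mxvec.
move=> [ha hb]; split; try by apply/real_nsd_lmi; rewrite trmxK frobenius_mxvec.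
  by apply: le_trans ha; exact: sqr_ge0.
by apply: le_trans hb; exact: sqr_ge0.
Qed.

(** Since kappa > 0, the epigraph variables are best lowered to the squared deviations that bound
    them from below. *)
Lemma Lloc_le V Gam Lam l (U : 'M[R[i]]_#|ext A l|) a b : P7_feasible V U a b ->
  Lloc k f kappa Gam Lam U (dev_re V U) (dev_im V U) <= Lloc k f kappa Gam Lam U a b.
Proof.
move=> /P7_feasibleE[_ h]; rewrite /Lloc lerD2r lerD2l; apply: ler_sum => j jl.
by rewrite ler_pM2l ?divr_gt0 // lerD //; have [] := h j jl.
Qed.

(** The subtracted sum does not depend on [U], so both objectives have the same minimizers. *)
Lemma area_lagrE V Gam Lam l (U : 'M[R[i]]_#|ext A l|) :
  area_lagr (re_mean V) (im_mean V) Gam Lam U =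
  Lloc k f kappa Gam Lam U (dev_re V U) (dev_im V U)
  - \sum_(j in Nbar A l) (\tr ((Gam l j)^T *m re_mean V l j)
                          + \tr ((Lam l j)^T *m im_mean V l j)).
Proof.
rewrite /area_lagr /Lloc -!addrA; congr (_ + _); rewrite addrA -sumrN -!big_split.
apply: eq_bigr => j _; rewrite swap_re_mean swap_im_mean /dev_re /dev_im /deviation /=.
rewrite reMB_half imMB_half !mulmxBr !raddfB /re_mean /im_mean /=; ring.
Qed.

Lemma S1_S1' V W X Gam Lam V' :
  agree_on W (re_mean V) -> agree_on X (im_mean V) ->
  S1 k f kappa W X Gam Lam V' <-> S1' k f kappa V Gam Lam V'.
Proof.
move=> /swap_agree WV /swap_agree XV; rewrite S1_areas.
have hE l (U : 'M[R[i]]_#|ext A l|) :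
    area_lagr W X Gam Lam U = area_lagr (re_mean V) (im_mean V) Gam Lam U.
  by rewrite /area_lagr; congr (_ + _); apply: eq_bigr => j jl; rewrite WV // XV.
have dev_feas l (U : 'M[R[i]]_#|ext A l|) :
    psd U /\ inB U -> P7_feasible V U (dev_re V U) (dev_im V U).
  by move=> ?; apply/P7_feasibleE.
split=> S1V l.
  have [V'D V'min] := S1V l.
  exists (dev_re V (V' l)), (dev_im V (V' l)); split; first exact: dev_feas.
  move=> U a b Uf; apply: le_trans (Lloc_le _ _ Uf).
  by have /P7_feasibleE[/V'min] := Uf; rewrite !hE !area_lagrE lerD2r.
have [a [b [V'f V'min]]] := S1V l; split; first by have /P7_feasibleE[] := V'f.
move=> U UD; rewrite !hE !area_lagrE lerD2r; apply: le_trans (Lloc_le _ _ V'f) _.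
exact: V'min (dev_feas _ _ UD).
Qed.

(** One copy minus the average of both is half the difference of the copies, hence the factor kappa
    / 2. *)
Lemma S3_S2' W' X' Gam Lam Gam' Lam' V' :
  agree_on W' (re_mean V') -> agree_on X' (im_mean V') ->
  S3 kappa V' W' X' Gam Lam Gam' Lam' <-> S2' kappa V' Gam Lam Gam' Lam'.
Proof.
move=> /swap_agree WV /swap_agree XV.
have reE l j : j \in Nbar A l -> kappa *: (reM (own V' l j) - swap W' l j) =
    (kappa / 2) *: (reM (own V' l j) - reM (other V' l j)).
  move=> jl; rewrite WV // swap_re_mean /re_mean reMD.
  by apply/matrixP => a b; rewrite !mxE; field.
have imE l j : j \in Nbar A l -> kappa *: (imM (own V' l j) - swap X' l j) =
    (kappa / 2) *: (imM (own V' l j) - imM (other V' l j)).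
  move=> jl; rewrite XV // swap_im_mean /im_mean imMD.
  by apply/matrixP => a b; rewrite !mxE; field.
by split=> h l j jl; have := h l j jl; rewrite ?reE ?imE.
Qed.

End Updates.

Lemma sum_pair (V : nmodType) (I J : finType) (F : I * J -> V) :
  \sum_p F p = \sum_i \sum_j F (i, j).
Proof. by rewrite pair_bigA; apply: eq_bigr => -[]. Qed.

(** * Real coordinates of the matrices and multipliers *)

Section Coordinates.
Variables (R : realType) (G : network R) (L : nat) (A : 'I_L -> {set node G}).
Implicit Types (V : area_mats A) (W X Gam Lam : pair_mats A).

(* (area, (row, column, imaginary part?)), respectively
   (pair of areas, (row, column, imaginary part?)) *)
Local Notation crd := ('I_L * (bus_phase G * bus_phase G * bool))%type.
Local Notation pcrd := ('I_L * 'I_L * (bus_phase G * bus_phase G * bool))%type.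

Definition area_coord V (p : crd) : R :=
  let z := entry (V p.1) p.2.1.1 p.2.1.2 in
  if p.2.2 then complex.Im z else complex.Re z.

Definition pair_coord W X (p : pcrd) : R :=
  entry ((if p.2.2 then X else W) p.1.1 p.1.2) p.2.1.1 p.2.1.2.

Definition shared : pred pcrd := fun p =>
  [&& p.1.2 \in Nbar A p.1.1, p.2.1.1 \in Psh A p.1.1 p.1.2 & p.2.1.2 \in Psh A p.1.1 p.1.2].

Definition own_crd (p : pcrd) : crd := (p.1.1, p.2).

Definition flip (p : pcrd) : pcrd := ((p.1.2, p.1.1), p.2).

Lemma flipK : involutive flip.
Proof. by case=> [[l j] q]. Qed.

Lemma shared_flip p : shared (flip p) = shared p.
Proof. by case: p => [[l j] q]; rewrite /shared /= Nbar_sym Psh_sym. Qed.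

Lemma sum_shared (F : pcrd -> R) : \sum_(p | shared p) F p =
  \sum_l \sum_(j in Nbar A l) \sum_(s in Psh A l j) \sum_(t in Psh A l j)
    (F ((l, j), ((s, t), false)) + F ((l, j), ((s, t), true))).
Proof.
rewrite big_mkcond sum_pair sum_pair /=; apply: eq_bigr => l _.
rewrite [RHS]big_mkcond; apply: eq_bigr => j _; rewrite sum_pair sum_pair.
rewrite /shared /=; case: ifP => jl; last first.
  by rewrite big1 // => s _; rewrite big1 // => t _; rewrite big1.
rewrite [RHS]big_mkcond; apply: eq_bigr => s _; case: ifP => sP; last first.
  by rewrite big1 // => t _; rewrite big1.
rewrite [RHS]big_mkcond; apply: eq_bigr => t _; rewrite big_bool /=.
by case: ifP => _; rewrite ?addr0 // addrC.
Qed.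

Lemma entry_reM_own V l j s t : s \in Psh A l j -> t \in Psh A l j ->
  entry (reM (own V l j)) s t = area_coord V (l, ((s, t), false)).
Proof. by move=> sP tP; rewrite entry_map // entry_blk sP tP. Qed.

Lemma entry_imM_own V l j s t : s \in Psh A l j -> t \in Psh A l j ->
  entry (imM (own V l j)) s t = area_coord V (l, ((s, t), true)).
Proof. by move=> sP tP; rewrite entry_map // entry_blk sP tP. Qed.

Lemma entry_reM_other V l j s t : s \in Psh A l j -> t \in Psh A l j ->
  entry (reM (other V l j)) s t = area_coord V (j, ((s, t), false)).
Proof. by move=> sP tP; rewrite entry_map // entry_blk sP tP. Qed.

Lemma entry_imM_other V l j s t : s \in Psh A l j -> t \in Psh A l j ->
  entry (imM (other V l j)) s t = area_coord V (j, ((s, t), true)).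
Proof. by move=> sP tP; rewrite entry_map // entry_blk sP tP. Qed.

Lemma entry_swap W l j s t : s \in Psh A l j -> t \in Psh A l j ->
  entry (swap W l j) s t = entry (W j l) s t.
Proof. by move=> sP tP; rewrite entry_blk sP tP. Qed.

Definition penalty kap m (Y M : 'M[R]_m) : R :=
  \tr (Y^T *m M) + kap / 2 * frobenius M ^+ 2.

Lemma penaltyE kap l j (Y M : 'M[R]_#|Psh A l j|) : penalty kap Y M =
  \sum_(s in Psh A l j) \sum_(t in Psh A l j)
    (entry Y s t * entry M s t + kap / 2 * entry M s t ^+ 2).
Proof.
rewrite -(sum_mx_entry (fun y m => y * m + kap / 2 * m ^+ 2)) /penalty frobenius_sqr.
rewrite /mxtrace (eq_bigr (fun b => \sum_a Y a b * M a b)); last first.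
  by move=> b _; rewrite mxE; apply: eq_bigr => a _; rewrite mxE.
rewrite exchange_big mulr_sumr -big_split; apply: eq_bigr => a _.
by rewrite mulr_sumr -big_split.
Qed.

Variables (k : objective) (f : forall l : 'I_L, 'M[R[i]]_#|ext A l| -> R).

(** Puts the Lagrangian in the abstract form. [flip] appears because the constraint of the pair (l,
    j) compares V_j^(l) with W_l^(j), which is stored at (j, l). *)
Lemma Lagr_coord kap V W X Gam Lam :
  Lagr k f kap V W X Gam Lam = \sum_l Cloc k f (V l) +
    aug shared kap (pair_coord Gam Lam) (pair_coord W X \o flip) (area_coord V \o own_crd).
Proof.
rewrite /Lagr big_split /=; congr (_ + _); rewrite /aug sum_shared.
apply: eq_bigr => l _; apply: eq_bigr => j jl.
transitivity (penalty kap (Gam l j) (reM (own V l j) - swap W l j)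
              + penalty kap (Lam l j) (imM (own V l j) - swap X l j)).
  by rewrite /penalty; ring.
rewrite !penaltyE -big_split; apply: eq_bigr => s sP; rewrite -big_split; apply: eq_bigr => t tP.
rewrite !entryD !entryN entry_reM_own // entry_imM_own // !entry_swap //.
Qed.

Lemma consensus_sym W X : consensus W X <-> s_sym shared flip (pair_coord W X \o flip).
Proof.
split=> [WX [[l j] [[s t] b]] /and3P[/= jl sP tP]|sym l j jl].
  have [W_eq X_eq] := WX l j jl.
  rewrite /pair_coord /=; case: b.
    by rewrite -X_eq entry_swap.
  by rewrite -W_eq entry_swap.
have e b s t : s \in Psh A l j -> t \in Psh A l j ->
    pair_coord W X ((l, j), ((s, t), b)) = pair_coord W X ((j, l), ((s, t), b)).
  by move=> sP tP; have /= := sym ((l, j), ((s, t), b)); rewrite /shared /= jl sP tP => ->.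
split; apply: entry_inj => s t sP tP; rewrite entry_swap //.
  by have := e false s t sP tP.
by have := e true s t sP tP.
Qed.

Lemma agree_mean_coord V W X :
  agree_on W (re_mean V) /\ agree_on X (im_mean V) <->
  forall p, shared p -> (pair_coord W X \o flip) p =
    involution_avg flip (area_coord V \o own_crd) p.
Proof.
have mE l j s t b : s \in Psh A l j -> t \in Psh A l j ->
    pair_coord (re_mean V) (im_mean V) ((l, j), ((s, t), b)) =
    2^-1 * (area_coord V (j, ((s, t), b)) + area_coord V (l, ((s, t), b))).
  move=> sP tP; rewrite /pair_coord /= [X in _ = _ * X]addrC.
  case: b; rewrite /re_mean /im_mean entryZ ?imMD ?reMD entryD.
    by rewrite entry_imM_own // entry_imM_other.
  by rewrite entry_reM_own // entry_reM_other.
split=> [[WV XV] [[l j] [[s t] b]] /and3P[/= jl sP tP]|h].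
  rewrite /involution_avg /= /own_crd /= -mE ?[Psh A j l]Psh_sym //.
  have lj : l \in Nbar A j by rewrite -Nbar_sym.
  by rewrite /pair_coord /=; case: b; rewrite ?WV ?XV.
have e l j s t b : j \in Nbar A l -> s \in Psh A l j -> t \in Psh A l j ->
    pair_coord W X ((l, j), ((s, t), b)) =
    pair_coord (re_mean V) (im_mean V) ((l, j), ((s, t), b)).
  move=> jl sP tP; rewrite mE //; have := h ((j, l), ((s, t), b)).
  rewrite /shared /= -Nbar_sym jl Psh_sym sP tP => -> //.
split=> l j jl; apply: entry_inj => s t sP tP.
  exact: (e l j s t false).
exact: (e l j s t true).
Qed.

(** Inverts [pair_coord] on shared coordinates, so that a coordinate-wise competitor becomes a pair
    of matrix families. *)
Definition pair_of (im : bool) (w : pcrd -> R) : pair_mats A :=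
  fun l j => \matrix_(a, b) w ((l, j), ((enum_val a, enum_val b), im)).

Lemma pair_coord_of w p : shared p ->
  pair_coord (pair_of false w) (pair_of true w) p = w p.
Proof.
case: p => [[l j] [[s t] b]] /and3P[/= _ sP tP]; rewrite /pair_coord /=.
by case: b; rewrite (entry_matrix _ (fun s t => w ((l, j), ((s, t), _)))) sP tP.
Qed.

Lemma aug_ext (kap : R) (y w w' v : pcrd -> R) :
  (forall p, shared p -> w p = w' p) -> aug shared kap y w v = aug shared kap y w' v.
Proof. by move=> ww; apply: eq_bigr => p Qp; rewrite ww. Qed.

Lemma S2_mean (kap : R) V W X Gam Lam : 0 < kap ->
  s_anti shared flip (pair_coord Gam Lam) ->
  S2 k f kap V Gam Lam W X <-> agree_on W (re_mean V) /\ agree_on X (im_mean V).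
Proof.
move=> kap0 ya; rewrite agree_mean_coord; split=> [[/consensus_sym ws wmin]|wE].
  apply/(aug_sym_minimizer flipK shared_flip _ kap0 ya ws) => w' w's.
  have sym' : s_sym shared flip (pair_coord (pair_of false (w' \o flip))
      (pair_of true (w' \o flip)) \o flip).
    move=> p Qp /=; rewrite !pair_coord_of ?shared_flip //= !flipK.
    exact: w's.
  have := wmin _ _ ((consensus_sym _ _).2 sym'); rewrite !Lagr_coord lerD2l.
  rewrite (@aug_ext _ _ (pair_coord (pair_of _ _) _ \o flip) w') //.
  by move=> p Qp /=; rewrite pair_coord_of ?shared_flip //= flipK.
have ws : s_sym shared flip (pair_coord W X \o flip).
  by move=> p Qp; rewrite !wE ?shared_flip // (avg_sym flipK _ Qp).
split=> [|W' X' /consensus_sym ws']; first exact/consensus_sym.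
rewrite !Lagr_coord lerD2l.
by move: ws' wE => + /(aug_sym_minimizer flipK shared_flip _ kap0 ya ws) => /[swap]; apply.
Qed.

Lemma S2'_coord kap V Gam Lam Gam' Lam' : S2' kap V Gam Lam Gam' Lam' ->
  forall p, shared p -> pair_coord Gam' Lam' p = pair_coord Gam Lam p
    + kap / 2 * (area_coord V (own_crd p) - area_coord V (own_crd (flip p))).
Proof.
move=> h [[l j] [[s t] b]] /and3P[/= jl sP tP]; have [G' L'] := h l j jl.
rewrite /pair_coord /=; case: b; rewrite ?G' ?L' entryD entryZ entryD entryN.
  by rewrite entry_imM_own // entry_imM_other.
by rewrite entry_reM_own // entry_reM_other.
Qed.

Lemma S2'_anti kap V Gam Lam Gam' Lam' : S2' kap V Gam Lam Gam' Lam' ->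
  s_anti shared flip (pair_coord Gam Lam) -> s_anti shared flip (pair_coord Gam' Lam').
Proof.
move=> /S2'_coord h ya p Qp; rewrite !h ?shared_flip // ya // flipK; ring.
Qed.

Lemma zero_init_coord (Gam Lam : nat -> pair_mats A) p : zero_init Gam Lam -> shared p ->
  pair_coord (Gam 0%N) (Lam 0%N) p = 0.
Proof.
case: p => [[l j] [[s t] b]] h /and3P[/= jl _ _]; have [G0 L0] := h l j jl.
by rewrite /pair_coord /=; case: b; rewrite ?G0 ?L0 entry0.
Qed.

Lemma zero_init_anti (Gam Lam : nat -> pair_mats A) : zero_init Gam Lam ->
  s_anti shared flip (pair_coord (Gam 0%N) (Lam 0%N)).
Proof. by move=> h p Qp; rewrite !(zero_init_coord h) ?shared_flip // oppr0. Qed.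

Theorem admm_run_primal_dual (kap : R) (V : nat -> area_mats A) (Gam Lam : nat -> pair_mats A) :
  0 < kap -> zero_init Gam Lam ->
  (exists W X : nat -> pair_mats A, admm_run k f kap V W X Gam Lam)
  <-> primal_dual_run k f kap V Gam Lam.
Proof.
move=> kap0 init; split=> [[W [X [WX0 run]]] i|run].
  (* Invariant of the run: auxiliary matrices are averages, and the multipliers of the two copies
     are opposite. The second part makes the next [S2] an averaging, which in turn keeps the
     multipliers opposite. *)
  suff : forall i, [/\ agree_on (W i) (re_mean (V i)), agree_on (X i) (im_mean (V i))
      & s_anti shared flip (pair_coord (Gam i) (Lam i))].
    move=> inv; have [Wi Xi yi] := inv i; have [WSi XSi _] := inv i.+1.
    have [s1 _ s3] := run i.
    by split; [apply/(S1_S1' k f kap0 _ _ _ Wi Xi)|apply/(S3_S2' _ _ _ _ _ WSi XSi)].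
  elim=> [|{}i [_ _ yi]].
    by split; [move=> l j /WX0[]|move=> l j /WX0[]|exact: zero_init_anti].
  have [_ /(S2_mean _ _ _ kap0 yi)[WSi XSi] s3] := run i.
  split=> //; apply: S2'_anti yi; apply/(S3_S2' _ _ _ _ _ WSi XSi); exact: s3.
have ya i : s_anti shared flip (pair_coord (Gam i) (Lam i)).
  elim: i => [|i IH]; first exact: zero_init_anti.
  exact: S2'_anti (run i).2 IH.
exists (fun i => re_mean (V i)), (fun i => im_mean (V i)); split=> // i.
have [s1 s2] := run i; split.
- by apply/(S1_S1' k f kap0 (V := V i)).
- by apply/S2_mean.
- by apply/S3_S2'.
Qed.

End Coordinates.

(** * Convergence of the simplified updates *)

Section AffineFunctionals.
Variables (R : realType) (K : finType).
Local Open Scope complex_scope.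

Definition affine_fun (g : (K -> R) -> R) :=
  exists (c0 : R) (c : K -> R), forall x, g x = c0 + lin_cost c x.

Lemma affine_const a : affine_fun (fun=> a).
Proof.
by exists a, (fun=> 0) => x; rewrite /lin_cost big1 ?addr0 // => k _; rewrite mul0r.
Qed.

Lemma affine_coord k : affine_fun (fun x => x k).
Proof.
exists 0, (fun k' => (k' == k)%:R) => x; rewrite add0r /lin_cost (bigD1 k) //= eqxx mul1r.
by rewrite big1 ?addr0 // => k' /negbTE ->; rewrite mul0r.
Qed.

Lemma affineD g h : affine_fun g -> affine_fun h -> affine_fun (fun x => g x + h x).
Proof.
move=> [g0 [gc gE]] [h0 [hc hE]]; exists (g0 + h0), (fun k => gc k + hc k) => x.
rewrite gE hE /lin_cost addrACA -big_split; congr (_ + _).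
by apply: eq_bigr => k _; rewrite mulrDl.
Qed.

Lemma affineZ a g : affine_fun g -> affine_fun (fun x => a * g x).
Proof.
move=> [g0 [gc gE]]; exists (a * g0), (fun k => a * gc k) => x.
rewrite gE mulrDr /lin_cost mulr_sumr; congr (_ + _).
by apply: eq_bigr => k _; rewrite mulrA.
Qed.

Lemma affine_eq g h : g =1 h -> affine_fun g -> affine_fun h.
Proof. by move=> gh [c0 [c gE]]; exists c0, c => x; rewrite -gh. Qed.

Lemma affineB g h : affine_fun g -> affine_fun h -> affine_fun (fun x => g x - h x).
Proof.
move=> ag ah; apply: (@affine_eq (fun x => g x + -1 * h x)) => [x|]; first by rewrite mulN1r.
exact/affineD/affineZ.
Qed.

Lemma affine_sum (I : finType) (P : pred I) (g : I -> (K -> R) -> R) :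
  (forall i, P i -> affine_fun (g i)) -> affine_fun (fun x => \sum_(i | P i) g i x).
Proof.
move=> ag; elim: (index_enum I) => [|i s IH].
  by apply: affine_eq (affine_const 0) => x; rewrite big_nil.
have [Pi|nPi] := boolP (P i).
  by apply: affine_eq (affineD (ag i Pi) IH) => x; rewrite big_cons Pi.
by apply: affine_eq IH => x; rewrite big_cons (negbTE nPi).
Qed.

Lemma affine_convex g x z t : affine_fun g ->
  g (fun k => z k + t * (x k - z k)) = g z + t * (g x - g z).
Proof.
move=> [c0 [c gE]]; rewrite !gE.
have -> : lin_cost c (fun k => z k + t * (x k - z k)) =
    lin_cost c z + t * (lin_cost c x - lin_cost c z).
  rewrite /lin_cost -sumrB mulr_sumr -big_split; apply: eq_bigr => k _ /=; ring.
ring.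
Qed.

Lemma affine_cvg g (F : set_system nat) (u : nat -> K -> R) (v : K -> R) : Filter F ->
  affine_fun g -> (forall k, (u i k @[i --> F] --> v k)%classic) ->
  (g (u i) @[i --> F] --> g v)%classic.
Proof.
move=> FF [c0 [c gE]] uv; rewrite gE.
have -> : (fun i => g (u i)) = (fun i => c0 + lin_cost c (u i)) by apply/funext => i.
apply: cvgD; first exact: cvg_cst.
by apply: cvg_sumr => k _; apply: cvgM => //; exact: cvg_cst.
Qed.

(** Affine over the reals, so that conjugation preserves it. *)
Definition caffine (g : (K -> R) -> R[i]) :=
  affine_fun (fun x => complex.Re (g x)) /\ affine_fun (fun x => complex.Im (g x)).

Lemma caffine_const c : caffine (fun=> c).
Proof. by split; exact: affine_const. Qed.

Lemma caffine_eq g h : g =1 h -> caffine g -> caffine h.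
Proof.
by move=> gh [ag1 ag2]; split; [move: ag1|move: ag2]; apply: affine_eq => x; rewrite gh.
Qed.

Lemma caffineD g h : caffine g -> caffine h -> caffine (fun x => g x + h x).
Proof.
move=> [g1 g2] [h1 h2]; split.
  by apply: affine_eq (affineD g1 h1) => x; rewrite raddfD.
by apply: affine_eq (affineD g2 h2) => x; rewrite raddfD.
Qed.

Lemma caffineM c g : caffine g -> caffine (fun x => c * g x).
Proof.
case: c => a b [g1 g2]; split.
  by apply: affine_eq (affineB (affineZ a g1) (affineZ b g2)) => x; case: (g x).
apply: affine_eq (affineD (affineZ a g2) (affineZ b g1)) => x; case: (g x) => ? ? /=.
by rewrite [in RHS]addrC; ring.
Qed.

Lemma caffine_conj g : caffine g -> caffine (fun x => (g x)^*).
Proof.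
move=> [g1 g2]; split; first by apply: affine_eq g1 => x; case: (g x).
by apply: affine_eq (affineZ (-1) g2) => x; case: (g x) => a b; rewrite mulN1r.
Qed.

Lemma caffine_sum (I : finType) (P : pred I) (g : I -> (K -> R) -> R[i]) :
  (forall i, P i -> caffine (g i)) -> caffine (fun x => \sum_(i | P i) g i x).
Proof.
move=> ag; elim: (index_enum I) => [|i s IH].
  by apply: caffine_eq (caffine_const 0) => x; rewrite big_nil.
have [Pi|nPi] := boolP (P i).
  by apply: caffine_eq (caffineD (ag i Pi) IH) => x; rewrite big_cons Pi.
by apply: caffine_eq IH => x; rewrite big_cons (negbTE nPi).
Qed.

(** The two halves are the hypotheses [D_convex] and [D_closed] of the abstract convergence
    theorem. *)
Definition closed_convex (P : (K -> R) -> Prop) :=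
  (forall x z (t : R), 0 <= t <= 1 -> P x -> P z -> P (fun k => z k + t * (x k - z k))) /\
  (forall (F : set_system nat) (u : nat -> K -> R) (v : K -> R), ProperFilter F ->
     (forall i, P (u i)) -> (forall k, (u i k @[i --> F] --> v k)%classic) -> P v).

Lemma closed_convex_ge0 g : affine_fun g -> closed_convex (fun x => 0 <= g x).
Proof.
move=> ag; split=> [x z t /andP[t0 t1] gx gz|F u v PF gu uv].
  rewrite affine_convex //; have -> : g z + t * (g x - g z) = (1 - t) * g z + t * g x by ring.
  by rewrite addr_ge0 // mulr_ge0 // subr_ge0.
have gv : (g (u i) @[i --> F] --> g v)%classic by exact: affine_cvg.
rewrite -(cvg_lim _ gv) //; apply: limr_ge; first by apply/cvg_ex; exists (g v).
exact: filterE.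
Qed.

Lemma closed_convex_iff P Q : (forall x, P x <-> Q x) -> closed_convex P -> closed_convex Q.
Proof.
move=> PQ [Pconv Pcl]; split=> [x z t t01 /PQ Px /PQ Pz|F u v PF Pu uv].
  exact/PQ/Pconv.
by apply/PQ; apply: Pcl uv => i; exact/PQ.
Qed.

Lemma closed_convex_forall (I : Type) (P : I -> (K -> R) -> Prop) :
  (forall i, closed_convex (P i)) -> closed_convex (fun x => forall i, P i x).
Proof.
move=> cP; split=> [x z t t01 Px Pz i|F u v PF Pu uv i].
  exact: (cP i).1.
exact: (cP i).2 uv.
Qed.

Lemma closed_convex_and P Q : closed_convex P -> closed_convex Q ->
  closed_convex (fun x => P x /\ Q x).
Proof.
move=> [P1 P2] [Q1 Q2]; split=> [x z t t01 [Px Qx] [Pz Qz]|F u v PF PQu uv].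
  by split; [exact: P1|exact: Q1].
by split; [apply: P2 uv => i; have [] := PQu i|apply: Q2 uv => i; have [] := PQu i].
Qed.

Lemma closed_convex_imp (H : Prop) P : (H -> closed_convex P) ->
  closed_convex (fun x => H -> P x).
Proof. by move=> cP; apply: closed_convex_forall. Qed.

Lemma closed_convex_le g h : affine_fun g -> affine_fun h ->
  closed_convex (fun x => g x <= h x).
Proof.
move=> ag ah; apply: closed_convex_iff (closed_convex_ge0 (affineB ah ag)) => x.
by rewrite subr_ge0.
Qed.

Lemma closed_convex_eq g h : affine_fun g -> affine_fun h ->
  closed_convex (fun x => g x = h x).
Proof.
move=> ag ah; apply: closed_convex_iff
  (closed_convex_and (closed_convex_le ag ah) (closed_convex_le ah ag)) => x.
by split=> [[? ?]|->//]; apply/eqP; rewrite eq_le; apply/andP.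
Qed.

Lemma closed_convex_ceq g h : caffine g -> caffine h -> closed_convex (fun x => g x = h x).
Proof.
move=> [g1 g2] [h1 h2]; apply: closed_convex_iff
  (closed_convex_and (closed_convex_eq g1 h1) (closed_convex_eq g2 h2)) => x.
by case: (g x) (h x) => a b [a' b'] /=; split=> [[-> ->]|[-> ->]].
Qed.

(** In [R[i]], 0 <= z includes that z is real: one affine equation and one affine inequality. *)
Lemma closed_convex_cge0 g : caffine g -> closed_convex (fun x => 0 <= g x).
Proof.
move=> [g1 g2]; apply: closed_convex_iff
  (closed_convex_and (closed_convex_ge0 g1) (closed_convex_eq g2 (affine_const 0))) => x.
case: (g x) => a b; rewrite lecE /= eq_sym.
by split=> [[-> ->]|/andP[/eqP -> ->]]; rewrite ?eqxx.
Qed.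

Lemma closed_convex_between a b g : affine_fun g -> closed_convex (fun x => a <= g x <= b).
Proof.
move=> ag; apply: closed_convex_iff (closed_convex_and
  (closed_convex_le (affine_const a) ag) (closed_convex_le ag (affine_const b))) => x.
by split=> [[-> ->]|/andP[]].
Qed.

End AffineFunctionals.

(** * Real-affine functions of Hermitian matrices *)

Section HermitianAffine.
Variables (R : realType) (n : nat) (f : 'M[R[i]]_n -> R).
Local Open Scope complex_scope.
Hypothesis f_affine : forall (U V : 'M[R[i]]_n) (t : R),
  U \is hermsymmx -> V \is hermsymmx ->
  f (t%:C *: U + (1 - t)%:C *: V) = t * f U + (1 - t) * f V.

Lemma herm0 : (0 : 'M[R[i]]_n) \is hermsymmx.
Proof. by rewrite hermsymmxE trmx0 map_mx0. Qed.

Lemma hermD (U V : 'M[R[i]]_n) : U \is hermsymmx -> V \is hermsymmx -> U + V \is hermsymmx.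
Proof. by rewrite !hermsymmxE trmxCD => /eqP <- /eqP <-. Qed.

Lemma hermZ (t : R) (U : 'M[R[i]]_n) : U \is hermsymmx -> t%:C *: U \is hermsymmx.
Proof.
rewrite !hermsymmxE => /eqP Uh; apply/eqP/matrixP => a b.
rewrite {1}Uh !mxE rmorphM /=; congr (_ * _).
by apply/esym; exact: conjc_real.
Qed.

Let g U := f U - f 0.

Lemma affine_part_Z t U : U \is hermsymmx -> g (t%:C *: U) = t * g U.
Proof.
move=> Uh; have := f_affine t Uh herm0; rewrite scaler0 addr0 /g => ->; ring.
Qed.

Lemma affine_part_D U V : U \is hermsymmx -> V \is hermsymmx -> g (U + V) = g U + g V.
Proof.
(* U + V is the midpoint of 2 U and 2 V, which turns affinity into additivity. *)
move=> Uh Vh; have := f_affine 2^-1 (hermZ 2 Uh) (hermZ 2 Vh).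
have -> : 1 - 2^-1 = 2^-1 :> R by field.
have h2 : (2^-1)%:C * 2%:C = 1 :> R[i] by rewrite -rmorphM /= mulVf ?pnatr_eq0.
rewrite !scalerA h2 !scale1r => E.
have := affine_part_Z 2 Uh; have := affine_part_Z 2 Vh; rewrite /g E; lra.
Qed.

Lemma affine_part_sum (I : finType) (F : I -> 'M[R[i]]_n) :
  (forall i, F i \is hermsymmx) ->
  \sum_i F i \is hermsymmx /\ g (\sum_i F i) = \sum_i g (F i).
Proof.
move=> Fh; elim: (index_enum I) => [|i s [IH1 IH2]].
  by rewrite !big_nil herm0 /g subrr.
by rewrite !big_cons hermD // affine_part_D // IH2.
Qed.

(** With [herm_im], a redundant real spanning family of the Hermitian matrices: exchanging a and b
    changes at most the sign. Thanks to the redundancy, the coefficients over all pairs are simply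
    the real and imaginary parts of the entries. *)
Definition herm_re (a b : 'I_n) : 'M[R[i]]_n := 2^-1 *: (delta_mx a b + delta_mx b a).
Definition herm_im (a b : 'I_n) : 'M[R[i]]_n := ('i%C / 2) *: (delta_mx a b - delta_mx b a).

Lemma herm_re_herm a b : herm_re a b \is hermsymmx.
Proof.
rewrite hermsymmxE; apply/eqP/matrixP => u v; rewrite !mxE rmorphM rmorphD half_complex.
rewrite [X in _ = X * _]conjc_real addrC; congr (_ * (_ + _)).
  by rewrite andbC; apply/esym; exact: conjc_nat.
by rewrite andbC; apply/esym; exact: conjc_nat.
Qed.

Lemma herm_im_herm a b : herm_im a b \is hermsymmx.
Proof.
have conj_i2 : ('i%C / 2 : R[i])^* = - ('i%C / 2).
  by rewrite half_complex; apply/eqP; rewrite eq_complex /=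
     !(mul0r, mulr0, mul1r, subr0, addr0, oppr0) !eqxx.
rewrite hermsymmxE; apply/eqP/matrixP => u v; rewrite !mxE rmorphM rmorphB.
rewrite [X in _ = X * _]conj_i2 mulNr -mulrN opprB; congr (_ * (_ - _)).
  by rewrite andbC; apply/esym; exact: conjc_nat.
by rewrite andbC; apply/esym; exact: conjc_nat.
Qed.

Lemma herm_decomposition (V : 'M[R[i]]_n) : V \is hermsymmx ->
  V = \sum_a \sum_b ((complex.Re (V a b))%:C *: herm_re a b
                     + (complex.Im (V a b))%:C *: herm_im a b).
Proof.
rewrite hermsymmxE => /eqP Vh.
rewrite [LHS](_ : V = 2^-1 *: (V + V^t*)); last first.
  by rewrite -Vh -mulr2n -(scaler_nat 2 V) scalerA mulVf ?scale1r // pnatr_eq0.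
rewrite [X in _ *: (X + _)]matrix_sum_delta [X in _ *: (_ + X)]matrix_sum_delta.
rewrite [X in _ *: (_ + X)]exchange_big /=.
rewrite -big_split scaler_sumr /=; apply: eq_bigr => a _.
rewrite -big_split scaler_sumr /=; apply: eq_bigr => b _ /=.
rewrite /herm_re /herm_im; apply/matrixP => u v; rewrite !mxE.
set z := V a b; have -> : Num.conj z = (complex.Re z)%:C - 'i%C * (complex.Im z)%:C.
  have -> : Num.conj z = z^*%C by [].
  by case: z => x y; simpc.
rewrite [X in _ * (X * _ + _)]complexE; ring.
Qed.

(** [f] is affine on Hermitian matrices only; the right-hand side is affine in all coordinates and
    can stand for it in the abstract theorem. *)
Lemma affine_herm_coord V : V \is hermsymmx ->
  f V = f 0 + \sum_a \sum_b (complex.Re (V a b) * g (herm_re a b)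
                           + complex.Im (V a b) * g (herm_im a b)).
Proof.
move=> Vh; suff -> : \sum_a \sum_b (complex.Re (V a b) * g (herm_re a b)
    + complex.Im (V a b) * g (herm_im a b)) = g V by rewrite /g addrC subrK.
have th a b : (complex.Re (V a b))%:C *: herm_re a b + (complex.Im (V a b))%:C *: herm_im a b
    \is hermsymmx.
  by apply: hermD; apply: hermZ; [exact: herm_re_herm|exact: herm_im_herm].
rewrite [in RHS](herm_decomposition Vh).
have [_ ->] := affine_part_sum (fun a => (affine_part_sum (th a)).1).
apply: eq_bigr => a _; have [_ ->] := affine_part_sum (th a); apply: eq_bigr => b _.
rewrite affine_part_D ?affine_part_Z ?hermZ ?herm_re_herm ?herm_im_herm //.
Qed.

End HermitianAffine.

(** * Entry bounds for positive semidefinite matrices *)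

Section PSDEntryBound.
Variable R : realType.
Local Open Scope complex_scope.

Lemma Re_form_add n (M : 'M[R[i]]_n) (a b : 'I_n) (w : R[i]) : psd M ->
  0 <= complex.Re (M a a + w * M a b + w^* * M b a + w^* * w * M b b).
Proof.
move=> psdM; pose u : 'cV[R[i]]_n := delta_mx a 0 + w *: delta_mx b 0.
have uE : u^t* = delta_mx 0 a + w^* *: delta_mx 0 b.
  by apply/matrixP => i j; rewrite !mxE rmorphD rmorphM /=; congr (_ + _ * _);
     rewrite andbC; exact: conjc_nat.
have de i j : delta_mx (0 : 'I_1) i *m M *m delta_mx j (0 : 'I_1) = (M i j)%:M.
  by rewrite -rowE -colE; apply/matrixP => x y; rewrite !mxE !ord1 mulr1n.
have := psdM.2 u; rewrite uE !(mulmxDl, mulmxDr) -!scalemxAl -!scalemxAr !de.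
rewrite !mxE eqxx !mulr1n !mulrA lecE => /andP[_]; congr (0 <= complex.Re _); ring.
Qed.

(** The form at e_a + w e_b is nonnegative: w = 1 and w = -1 bound the real part of the entry by the
    mean of two diagonal entries, w = i and w = -i the imaginary part. *)
Lemma psd_entry_bound n (M : 'M[R[i]]_n) (B : R) (a b : 'I_n) : psd M ->
  (forall c, complex.Re (M c c) <= B) ->
  `|complex.Re (M a b)| <= B /\ `|complex.Im (M a b)| <= B.
Proof.
move=> psdM dB; have ha := dB a; have hb := dB b.
have Mba : M b a = (M a b)^*.
  by have := congr1 (fun N : 'M_n => N b a) (psd_herm psdM); rewrite !mxE => <-.
have h1 := Re_form_add a b 1 psdM; have h2 := Re_form_add a b (-1) psdM.
have h3 := Re_form_add a b 'i%C psdM; have h4 := Re_form_add a b (- 'i%C) psdM.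
move: h1 h2 h3 h4 ha hb; rewrite Mba.
case: (M a b) (M a a) (M b b) => [x y] [x1 y1] [x2 y2] /=.
rewrite !(mul0r, mulr0, mul1r, mulr1, subr0, addr0, oppr0, add0r, sub0r, mulNr, mulrN, opprK).
by move=> h1 h2 h3 h4 ha hb; rewrite !ler_norml; split; apply/andP; split; lra.
Qed.

End PSDEntryBound.

(** * The feasible set in real coordinates *)

Section Domain.
Variables (R : realType) (G : network R) (L : nat) (A : 'I_L -> {set node G}).
Local Open Scope complex_scope.
Local Notation crd := ('I_L * (bus_phase G * bus_phase G * bool))%type.

Definition mats_of (x : crd -> R) : area_mats A := fun l =>
  \matrix_(a, b) (x (l, ((enum_val a, enum_val b), false))
                  +i* x (l, ((enum_val a, enum_val b), true))).

Definition in_ext (p : crd) := (p.2.1.1 \in ext A p.1) && (p.2.1.2 \in ext A p.1).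

Lemma mats_of_coord (V : area_mats A) : mats_of (area_coord V) = V.
Proof.
apply: functional_extensionality_dep => l; apply/matrixP => a b.
by rewrite mxE /area_coord /= entry_enum_val; case: (V l a b).
Qed.

Lemma area_coord_out (V : area_mats A) p : ~~ in_ext p -> area_coord V p = 0.
Proof. by move=> out; rewrite /area_coord entry_out // if_same. Qed.

(** Coordinates outside the extended areas are pinned to 0, which makes [area_coord] and [mats_of]
    inverse to each other. *)
Definition domain (x : crd -> R) :=
  V_domain (mats_of x) /\ forall p, ~~ in_ext p -> x p = 0.

Lemma coord_mats_of x : domain x -> area_coord (mats_of x) = x.
Proof.
move=> [_ xout]; apply/funext => p; have [inp|out] := boolP (in_ext p); last first.
  by rewrite area_coord_out // xout.
case: p inp => [l [[s t] b]] /andP[/= sl tl]; rewrite /area_coord /=.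
by rewrite (entry_rank _ sl tl) mxE !enum_rankK_in //; case: b.
Qed.

Lemma coord_domain (V : area_mats A) : V_domain V -> domain (area_coord V).
Proof. by move=> VD; split=> [|p]; [rewrite mats_of_coord|exact: area_coord_out]. Qed.

Lemma caffine_mats l a b : caffine (fun x => mats_of x l a b).
Proof.
split.
  by apply: affine_eq (affine_coord _ (l, ((enum_val a, enum_val b), false))) => x; rewrite mxE.
by apply: affine_eq (affine_coord _ (l, ((enum_val a, enum_val b), true))) => x; rewrite mxE.
Qed.

Lemma caffine_entry l s t : caffine (fun x => entry (mats_of x l) s t).
Proof. by apply: caffine_sum => a _; apply: caffine_sum => b _; exact: caffine_mats. Qed.

Lemma affine_trR l (Phi : 'M[R[i]]_#|ext A l|) : affine_fun (fun x => trR Phi (mats_of x l)).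
Proof.
suff [] : caffine (fun x => \tr (Phi *m mats_of x l)) by [].
apply: (@caffine_eq _ _ (fun x => \sum_a \sum_b Phi a b * mats_of x l b a)).
  by move=> x; apply: eq_bigr => a _; rewrite mxE.
by apply: caffine_sum => a _; apply: caffine_sum => b _; apply/caffineM/caffine_mats.
Qed.

Lemma closed_convex_psd l : closed_convex (fun x => psd (mats_of x l)).
Proof.
apply: closed_convex_and.
  apply: (@closed_convex_iff _ _ (fun x => forall a b, mats_of x l a b = (mats_of x l b a)^*)).
    move=> x; rewrite hermsymmxE; split=> [h|/eqP h a b].
      by apply/eqP/matrixP => a b; rewrite h [RHS]mxE [X in _ = Num.conj X]mxE.
    by rewrite {1}h [LHS]mxE [X in Num.conj X]mxE.
  apply: closed_convex_forall => a; apply: closed_convex_forall => b.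
  by apply: closed_convex_ceq; [|apply: caffine_conj]; exact: caffine_mats.
apply: closed_convex_forall => w; apply: closed_convex_cge0.
apply: (@caffine_eq _ _ (fun x => \sum_b w b 0 * \sum_a (w^t*) 0 a * mats_of x l a b)).
  by move=> x; rewrite mxE; apply: eq_bigr => b _; rewrite mulrC mxE.
apply: caffine_sum => b _; apply/caffineM/caffine_sum => a _; exact/caffineM/caffine_mats.
Qed.

Lemma closed_convex_inB l : closed_convex (fun x => inB (mats_of x l)).
Proof.
pose tr (Phi : 'M[R[i]]_#|busphases G|) x := trR (blk (ext A l) Phi) (mats_of x l).
have aff Phi : affine_fun (tr Phi) by exact: affine_trR.
apply: closed_convex_and.
  apply: (@closed_convex_iff _ _ (fun x =>
    (forall n p, n \in A l -> n \notin ord0 |: DG G -> p \in phases n ->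
        tr (PhiP n p) x + PL n p = 0) /\
    (forall n p, n \in A l -> n \notin ord0 |: DG G -> p \in phases n ->
        tr (PhiQ n p) x + QL n p - yC n p * tr (PhiV n p) x = 0) /\
    (forall s p, s \in A l -> s \in DG G -> p \in phases s ->
        PGmin s <= tr (PhiP s p) x + PL s p <= PGmax s) /\
    (forall s p, s \in A l -> s \in DG G -> p \in phases s ->
        QGmin s <= tr (PhiQ s p) x + QL s p <= QGmax s) /\
    (forall n p, n \in A l -> p \in phases n ->
        Vmin n ^+ 2 <= tr (PhiV n p) x <= Vmax n ^+ 2))).
    by move=> x; split=> [[? [? [? []]]]|[]].
  do 4?(apply: closed_convex_and); apply: closed_convex_forall => n;
    apply: closed_convex_forall => p; do 3?(apply: closed_convex_imp => ?).
  - apply: closed_convex_eq; last exact: affine_const.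
    by apply: affineD => //; exact: affine_const.
  - apply: closed_convex_eq; last exact: affine_const.
    apply: affineB; last exact: affineZ.
    by apply: affineD => //; exact: affine_const.
  - by apply: closed_convex_between; apply: affineD => //; exact: affine_const.
  - by apply: closed_convex_between; apply: affineD => //; exact: affine_const.
  - exact: closed_convex_between.
apply: closed_convex_imp => _; rewrite /pcc_constraint.
apply: (@closed_convex_iff _ _ (fun x => forall p q,
    entry (mats_of x l) (ord0, p) (ord0, q) = (v0 G *m (v0 G)^t*) p q)).
  move=> x; split=> [h|h p q]; first by apply/matrixP => p q; rewrite [LHS]mxE h.
  by rewrite -h mxE.
apply: closed_convex_forall => p; apply: closed_convex_forall => q.
by apply: closed_convex_ceq; [exact: caffine_entry|exact: caffine_const].
Qed.

Lemma closed_convex_domain : closed_convex domain.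
Proof.
apply: closed_convex_and.
  apply: closed_convex_forall => l; apply: closed_convex_and.
    exact: closed_convex_psd.
  exact: closed_convex_inB.
apply: closed_convex_forall => p; apply: closed_convex_imp => _.
by apply: closed_convex_eq; [exact: affine_coord|exact: affine_const].
Qed.

Lemma trR_PhiV l (V : 'M[R[i]]_#|ext A l|) s : s \in ext A l ->
  trR (blk (ext A l) (PhiV s.1 s.2)) V = complex.Re (entry V s s).
Proof.
move=> sl; rewrite /trR mxtrace_mul_entry; congr complex.Re.
have sb : s \in busphases G by apply: subsetP sl; exact: ext_sub.
have PhiE x y : entry (PhiV s.1 s.2) x y = ((x == s) && (y == s))%:R.
  have [/andP[xb yb]|out] := boolP ((x \in busphases G) && (y \in busphases G)).
    rewrite (entry_rank _ xb yb) mxE big_ord1 !mxE !enum_rankK_in //.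
    by rewrite -surjective_pairing -natrM mulnb.
  rewrite entry_out //; case: eqP out => //= ->; case: eqP => //= ->.
  by rewrite sb.
rewrite (bigD1 s) //= (bigD1 s) //= entry_blk sl PhiE eqxx mul1r /=.
rewrite big1 ?addr0 => [|y ys]; last first.
  by rewrite entry_blk PhiE eqxx (negbTE ys) /= if_same mul0r.
rewrite big1 ?addr0 // => x xs; rewrite big1 // => y _.
by rewrite entry_blk PhiE (negbTE xs) /= if_same mul0r.
Qed.

Hypothesis partA : area_partition A.

(* The voltage limits (e) bound the diagonal entries at the nodes of the area itself, the
   coordinates shared with the neighbouring areas those at the other nodes. *)
Lemma domain_bounded (M : R) : exists M' : R, forall x, domain x ->
  (forall p, shared A p -> `|x (own_crd p)| <= M) -> forall q, `|x q| <= M'.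
Proof.
pose S := \sum_n @Vmax R G n ^+ 2; exists (`|M| + S) => x xD xM.
have S0 : 0 <= S by apply: sumr_ge0 => n _; exact: sqr_ge0.
have [VD xout] := xD.
have diag l s : s \in ext A l -> complex.Re (entry (mats_of x l) s s) <= `|M| + S.
  move=> sl; have [sA|sA] := boolP (s.1 \in A l).
    have [[_ _ _ _ e] _] := (VD l).2.
    have sph : s.2 \in phases s.1 by move: sl; rewrite !inE => /andP[].
    have /andP[_] := e s.1 s.2 sA sph; rewrite trR_PhiV // => h; apply: le_trans h _.
    rewrite /S (bigD1 s.1) //= addrCA lerDl addr_ge0 //.
    by apply: sumr_ge0 => n _; exact: sqr_ge0.
  have [j sj] := area_ofP partA s.1.
  have sP : s \in Psh A l j.
    move: sl; rewrite !inE => /andP[-> h]; rewrite h /=; apply/orP; left; exact: sj.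
  have jl : j \in Nbar A l.
    rewrite in_set; apply/andP; split; first by apply: contraNneq sA => <-.
    by apply/set0Pn; exists s.1; move: sP; rewrite in_set => /andP[].
  have := xM ((l, j), ((s, s), false)); rewrite /shared /= jl sP => /(_ isT).
  have -> : x (own_crd ((l, j), ((s, s), false))) = complex.Re (entry (mats_of x l) s s).
    by rewrite -{1}(coord_mats_of xD).
  move=> h; apply: le_trans (ler_norm _) _; apply: le_trans h _.
  by have := ler_norm M; lra.
move=> q; have [inq|out] := boolP (in_ext q); last first.
  by rewrite xout // normr0 addr_ge0.
rewrite -(coord_mats_of xD) /area_coord.
have /andP[sl tl] := inq; rewrite (entry_rank _ sl tl).
have [|h1 h2] := @psd_entry_bound _ _ (mats_of x q.1) (`|M| + S)
  (enum_rank_in sl q.2.1.1) (enum_rank_in tl q.2.1.2) (VD q.1).1.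
  by move=> a; rewrite -entry_enum_val; apply: diag; exact: enum_valP.
by case: ifP.
Qed.

Variables (k : objective) (f : forall l : 'I_L, 'M[R[i]]_#|ext A l| -> R).
Hypothesis splitf : k = Supply -> C2_split f.

Lemma cost_affine : exists (c0 : R) (c : crd -> R), forall V : area_mats A, V_domain V ->
  \sum_l Cloc k f (V l) = c0 + lin_cost c (area_coord V).
Proof.
suff loc l : exists2 g, affine_fun g & forall x, mats_of x l \is hermsymmx ->
    Cloc k f (mats_of x l) = g x.
  have /choice [g gP] : forall l, exists g, affine_fun g /\
      forall x, mats_of x l \is hermsymmx -> Cloc k f (mats_of x l) = g x.
    by move=> l; have [g ? ?] := loc l; exists g.
  have [c0 [c cP]] := affine_sum (P := xpredT) (fun l _ => (gP l).1).
  exists c0, c => V VD; rewrite -cP; apply: eq_bigr => l _.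
  by rewrite -(gP l).2 mats_of_coord //; have [[]] := VD l.
case: k splitf => [_|/(_ erefl)[faff _]].
  exists (fun x => C1loc (mats_of x l)) => //; rewrite /C1loc.
  apply: affineD; apply: affine_sum => e _; last apply: affineZ; exact: affine_trR.
exists (fun x => @f l 0 + \sum_a \sum_b
    (complex.Re (mats_of x l a b) * (@f l (herm_re R a b) - @f l 0)
     + complex.Im (mats_of x l a b) * (@f l (herm_im R a b) - @f l 0))).
  apply: affineD; first exact: affine_const.
  apply: affine_sum => a _; apply: affine_sum => b _; have [re im] := caffine_mats a b.
  apply: affineD.
    by apply: affine_eq (affineZ (@f l (herm_re R a b) - @f l 0) re) => x; rewrite mulrC.
  by apply: affine_eq (affineZ (@f l (herm_im R a b) - @f l 0) im) => x; rewrite mulrC.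
by move=> x xh /=; apply: affine_herm_coord xh; exact: faff.
Qed.

End Domain.

(** * Convergence to the sub-matrices of the optimum *)

Section Convergence.
Variables (R : realType) (G : network R) (L : nat) (A : 'I_L -> {set node G}).
Variables (k : objective) (f : forall l : 'I_L, 'M[R[i]]_#|ext A l| -> R) (kappa : R).
Hypotheses (partA : area_partition A) (as1 : As1 A).
Hypotheses (splitf : k = Supply -> C2_split f) (kappa_gt0 : 0 < kappa).

Local Notation flip := (@flip R G L).
Local Notation flipK' := (@flipK R G L).
Local Notation own_crd := (@own_crd R G L).

Lemma agreeing_coord (V : area_mats A) :
  agreeing V <-> s_sym (shared A) flip (area_coord V \o own_crd).
Proof.
split=> [ag [[l j] [[s t] b]] /and3P[/= jl sP tP]|sym l j jl].
  have := congr1 (fun M => entry M s t) (ag l j jl).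
  by rewrite /own /other !entry_blk sP tP /own_crd /area_coord /= => ->.
apply: entry_inj => s t sP tP; rewrite !entry_blk sP tP /=.
have e b := sym ((l, j), ((s, t), b)).
move: (e false) (e true); rewrite /shared /= jl sP tP => /(_ isT) + /(_ isT).
rewrite /own_crd /area_coord /=.
by case: (entry (V l) s t) (entry (V j) s t) => a b [a' b'] /= -> ->.
Qed.

Lemma P6_feasible_coord (V : area_mats A) W X : P6_feasible V W X ->
  forall p, shared A p -> area_coord V (own_crd p) = pair_coord W X (flip p).
Proof.
move=> [_ _ VWX] [[l j] [[s t] b]] /and3P[/= jl sP tP].
have [reE imE] := VWX l j jl; rewrite /own_crd /flip /pair_coord /=; case: b.
  by rewrite -(entry_imM_own V sP tP) imE entry_swap.
by rewrite -(entry_reM_own V sP tP) reE entry_swap.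
Qed.

(** Minimality of the Lagrangian in the free auxiliary matrices forces opposite multipliers;
    minimality in the V^(l) gives the saddle inequality. *)
Lemma multipliers_saddle Gam Lam (c0 : R) c : P6_multipliers k f Gam Lam ->
  (forall V : area_mats A, V_domain V ->
     \sum_l Cloc k f (V l) = c0 + lin_cost c (area_coord V)) ->
  exists xo, saddle (shared A) own_crd flip (domain A) c
    xo (pair_coord Gam Lam).
Proof.
move=> [V [W [X [[Vfeas _] Lmin]]]] costE; have [VD cons _] := Vfeas.
have vw := P6_feasible_coord Vfeas.
have /consensus_sym ws := cons.
have aug0 (y w v : _ -> R) : aug (shared A) 0 y w v = \sum_(p | shared A p) y p * (v p - w p).
  by apply: eq_bigr => p _; rewrite mul0r mul0r addr0.
exists (area_coord V); split.
- exact: coord_domain.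
- by move=> p Qp /=; rewrite !vw ?shared_flip //; exact: ws.
- set y := pair_coord Gam Lam.
  suff y0 : forall p, shared A p -> involution_avg flip y p = 0.
    move=> p Qp; have := y0 p Qp; rewrite /involution_avg => /eqP.
    by rewrite mulf_eq0 invr_eq0 pnatr_eq0 /= addrC addr_eq0 => /eqP.
  (* The average of y is a symmetric direction, hence admissible. Shifting w by it lowers the
     Lagrangian by the sum of its squares, which must therefore be 0. *)
  pose w' p := pair_coord W X (flip p) + involution_avg flip y p.
  have w's : s_sym (shared A) flip w'.
    by move=> p Qp; rewrite /w' (avg_sym flipK' _ Qp); congr (_ + _); exact: ws.
  pose W' := pair_of A false (w' \o flip); pose X' := pair_of A true (w' \o flip).
  have w'E p : shared A p -> pair_coord W' X' (flip p) = w' p.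
    by move=> Qp; rewrite pair_coord_of ?shared_flip //= flipK'.
  have cons' : consensus W' X'.
    apply/consensus_sym => p Qp /=.
    by rewrite !w'E ?shared_flip // w's.
  have := Lmin V W' X' VD cons'; rewrite !Lagr_coord lerD2l !aug0 -subr_le0 -sumrB.
  have -> : \sum_(p | shared A p) (y p * ((area_coord V \o own_crd) p
        - (pair_coord W X \o flip) p)
      - y p * ((area_coord V \o own_crd) p - (pair_coord W' X' \o flip) p))
      = \sum_(p | shared A p) involution_avg flip y p ^+ 2.
    have o := sum_sym_anti flipK' (@shared_flip R G L A) (@avg_sym _ _ _ _ flipK' y)
      (@sub_avg_anti _ _ _ _ flipK' y).
    rewrite -[RHS]addr0 -[X in _ = _ + X]o -big_split; apply: eq_bigr => p Qp /=.
    by rewrite w'E // /w'; ring.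
  move=> le0 p Qp; apply/eqP; rewrite -sqrf_eq0.
  have /eqP : \sum_(p | shared A p) involution_avg flip y p ^+ 2 = 0.
    by apply/eqP; rewrite eq_le le0 sumr_ge0 // => q _; exact: sqr_ge0.
  by rewrite psumr_eq0 => [/allP/(_ p)|q _]; rewrite ?mem_index_enum ?Qp ?sqr_ge0 //= => ->.
- move=> z zD; have := Lmin (mats_of A z) W X zD.1 cons.
  rewrite !Lagr_coord !aug0 (costE _ VD) (costE _ zD.1) coord_mats_of //.
  set y := pair_coord Gam Lam; set w := _ \o flip.
  have -> : \sum_(p | shared A p) y p * (z (own_crd p) - area_coord V (own_crd p)) =
      \sum_(p | shared A p) y p * ((z \o own_crd) p - w p)
      - \sum_(p | shared A p) y p * ((area_coord V \o own_crd) p - w p).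
    by rewrite -sumrB; apply: eq_bigr => p _ /=; ring.
  lra.
Qed.

Theorem primal_dual_run_cvg (Vopt : 'M[R[i]]_#|busphases G|) (V : nat -> area_mats A)
    (Gam Lam : nat -> pair_mats A) :
  (forall U, P3_optimal k U -> forall l, blk (ext A l) U = blk (ext A l) Vopt) ->
  (exists Gam Lam : pair_mats A, P6_multipliers k f Gam Lam) ->
  zero_init Gam Lam -> primal_dual_run k f kappa V Gam Lam ->
  (forall l, mx_cvg (fun i => reM (V i l)) (reM (blk (ext A l) Vopt))
          /\ mx_cvg (fun i => imM (V i l)) (imM (blk (ext A l) Vopt)))
  /\ exists Gamoo Lamoo : pair_mats A, forall l j, j \in Nbar A l ->
       mx_cvg (fun i => Gam i l j) (Gamoo l j) /\ mx_cvg (fun i => Lam i l j) (Lamoo l j).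
Proof.
move=> uniq [Gam0 [Lam0 mult]] init run.
have [c0 [c costE]] := cost_affine (A := A) splitf.
have [xo sad] := multipliers_saddle mult costE.
have [Dconv Dclosed] := closed_convex_domain A.
(* [S1'] is read back as [S1] with the auxiliary matrices at the averages; the constant [c0] of the
   cost cancels. *)
have xS i : aug_argmin (shared A) own_crd (domain A) c kappa
    (pair_coord (Gam i) (Lam i))
    (involution_avg flip (area_coord (V i) \o own_crd)) (area_coord (V i.+1)).
  have /(S1_S1' (V := V i) k f kappa_gt0) : S1' k f kappa (V i) (Gam i) (Lam i) (V i.+1).
    exact: (run i).1.
  move=> /(_ (re_mean (V i)) (im_mean (V i))) [] // VD Vmin.
  split=> [|z zD]; first exact: coord_domain.
  have := Vmin _ zD.1; rewrite !Lagr_coord !costE ?zD.1 //; last exact: zD.1.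
  rewrite -!addrA lerD2l coord_mats_of //.
  have augE v : aug (shared A) kappa (pair_coord (Gam i) (Lam i))
      (pair_coord (re_mean (V i)) (im_mean (V i)) \o flip) v =
      aug (shared A) kappa (pair_coord (Gam i) (Lam i))
      (involution_avg flip (area_coord (V i) \o own_crd)) v.
    by apply: aug_ext; apply/agree_mean_coord; split.
  by rewrite !augE.
have yS i p : shared A p -> pair_coord (Gam i.+1) (Lam i.+1) p =
    pair_coord (Gam i) (Lam i) p + kappa / 2 *
    (area_coord (V i.+1) (own_crd p) - area_coord (V i.+1) (own_crd (flip p))).
  exact: (S2'_coord (run i).2).
(* A minimizer in coordinates is an agreeing family of least cost, hence consists of the
   sub-matrices of a solution of (P3), and [uniq] identifies them. *)
have xopt_unique v : domain A v ->
    s_sym (shared A) flip (v \o own_crd) ->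
    (forall z, domain A z -> s_sym (shared A) flip (z \o own_crd) ->
       lin_cost c v <= lin_cost c z) -> v =1 area_coord (restrict A Vopt).
  move=> vD vsym vmin p; rewrite -(coord_mats_of vD).
  have -> // : mats_of A v = restrict A Vopt.
  apply: functional_extensionality_dep => l.
  apply: (agreeing_minimizer_unique partA splitf as1 uniq) => //.
  - exact: vD.1.
  - by apply/agreeing_coord; rewrite coord_mats_of.
  move=> U UD Uag; rewrite !costE //; last exact: vD.1.
  rewrite lerD2l coord_mats_of //; apply: vmin; first exact: coord_domain.
  exact/agreeing_coord.
have [xcvg [yoo ycvg]] := admm_cvg flipK' (@shared_flip R G L A) Dconv kappa_gt0
  (y := fun i => pair_coord (Gam i) (Lam i)) (x := fun i => area_coord (V i))
  (fun p => zero_init_coord init) xS yS Dclosed (domain_bounded partA) xopt_unique sad.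
split=> [l|].
  have reE (U : area_mats A) a b :
      area_coord U (l, ((enum_val a, enum_val b), false)) = reM (U l) a b.
    by rewrite /area_coord /= entry_enum_val mxE.
  have imE (U : area_mats A) a b :
      area_coord U (l, ((enum_val a, enum_val b), true)) = imM (U l) a b.
    by rewrite /area_coord /= entry_enum_val mxE.
  split=> a b.
    have := xcvg (l, ((enum_val a, enum_val b), false)).
    by rewrite reE; under eq_fun do rewrite reE.
  have := xcvg (l, ((enum_val a, enum_val b), true)).
  by rewrite imE; under eq_fun do rewrite imE.
exists (pair_of A false yoo), (pair_of A true yoo) => l j jl.
have y_lj (a b : 'I_#|Psh A l j|) im := ycvg ((l, j), ((enum_val a, enum_val b), im)).
split=> a b; rewrite mxE.
  have := y_lj a b false; rewrite /shared /= jl !enum_valP => /(_ isT).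
  by rewrite /pair_coord /=; under eq_fun do rewrite entry_enum_val.
have := y_lj a b true; rewrite /shared /= jl !enum_valP => /(_ isT).
by rewrite /pair_coord /=; under eq_fun do rewrite entry_enum_val.
Qed.

End Convergence.

Theorem proposition3 (R : realType) (G : network R)
    (L : nat) (A : 'I_L -> {set node G})
    (k : objective) (f : forall l : 'I_L, 'M[R[i]]_#|ext A l| -> R) (kappa : R)
    (Ysym : (Ybus G)^T = Ybus G)
    (partA : area_partition A) (as1 : As1 A) (as2 : As2 A)
    (splitf : k = Supply -> C2_split f) (kappa_gt0 : 0 < kappa) :
  (forall (V : nat -> area_mats A) (Gam Lam : nat -> pair_mats A),
     (forall l, V 0%N l \is hermsymmx) -> zero_init Gam Lam ->
     (exists W X : nat -> pair_mats A, admm_run k f kappa V W X Gam Lam)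
     <-> primal_dual_run k f kappa V Gam Lam)
  /\
  (forall Vopt : 'M[R[i]]_#|busphases G|,
     P3_optimal k Vopt ->
     (forall U, P3_optimal k U ->
        forall l, blk (ext A l) U = blk (ext A l) Vopt) ->
     (exists Gam Lam : pair_mats A, P6_multipliers k f Gam Lam) ->
     forall (V : nat -> area_mats A) (Gam Lam : nat -> pair_mats A),
       (forall l, V 0%N l \is hermsymmx) -> zero_init Gam Lam ->
       primal_dual_run k f kappa V Gam Lam ->
       (forall l, mx_cvg (fun i => reM (V i l)) (reM (blk (ext A l) Vopt))
               /\ mx_cvg (fun i => imM (V i l)) (imM (blk (ext A l) Vopt)))
       /\ exists Gamoo Lamoo : pair_mats A,
            forall l j, j \in Nbar A l ->
              mx_cvg (fun i => Gam i l j) (Gamoo l j)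
              /\ mx_cvg (fun i => Lam i l j) (Lamoo l j)).
Proof.
split=> [V Gam Lam _ init|Vopt _ uniq mult V Gam Lam _ init run].
  exact: admm_run_primal_dual.
exact: (primal_dual_run_cvg partA as1 splitf kappa_gt0 uniq mult init run).
Qed.
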